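(* Consider the problem $\min_{x\in\mathbb{R}^{d_x}}\max_{y\in\mathbb{R}^{d_y}} r(x)+F(x,y)-g(y)$ under the assumptions stated in the context, and Algorithm FOAM described in the context, with parameters $$\theta_y = 8\mu_x^{-1},\quad \alpha=\min\{1,\sqrt{\theta_y\mu_y}\},\quad \lambda=\left(2\sqrt5\,(1+8L/\mu_x)\right)^{-1},\quad \gamma_x=8\mu_x^{-1},\quad \gamma_y=\theta_y,$$ $$\eta_z=\frac{\mu_x}{2},\quad \eta_y=\min\left\{\frac{1}{2\mu_y},\frac{\theta_y}{2\alpha}\right\},\quad \beta_t=\frac{2}{t+3}\ \ (t=0,1,2,\ldots).$$ Without loss of generality assume $\mu_x\ge\mu_y$ (otherwise swap the variables $x$ and $y$, i.e. apply the algorithm to the equivalent problem $\min_{y}\max_{x} g(y)-F(x,y)-r(x)$). Then, to find an $\epsilon$-accurate solution of the problem, FOAM has the gradient evaluation complexity $$\mathcal{O}\left(\frac{L}{\sqrt{\mu_x\mu_y}}\log\frac1\epsilon\right).$$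
   Context: Setting. $\mu_x,\mu_y,L>0$. $F:\mathbb{R}^{d_x}\times\mathbb{R}^{d_y}\to\mathbb{R}$ is continuously differentiable; $F(\cdot,y)$ is $\mu_x$-strongly convex for every $y$; $F(x,\cdot)$ is $\mu_y$-strongly concave for every $x$; and $F$ is $L$-smooth: $\|\nabla F(x_1,y_1)-\nabla F(x_2,y_2)\|^2\le L^2(\|x_1-x_2\|^2+\|y_1-y_2\|^2)$ for all $x_1,x_2,y_1,y_2$. The functions $r:\mathbb{R}^{d_x}\to\mathbb{R}\cup\{+\infty\}$ and $g:\mathbb{R}^{d_y}\to\mathbb{R}\cup\{+\infty\}$ are proper, lower semicontinuous and convex. The problem has a unique solution $(x^*,y^* )$, characterized by $-\nabla_xF(x^*,y^* )\in\partial r(x^* )$ and $\nabla_yF(x^*,y^* )\in\partial g(y^* )$. A pair $(x,y)$ is an $\epsilon$-accurate solution if $\|x-x^*\|^2+\|y-y^*\|^2\le\epsilon$. Notation. $\hat F(x,y)=F(x,y)-\frac{\mu_x}{2}\|x\|^2+\frac{\mu_y}{2}\|y\|^2$. For $c>0$, $\mathrm{prox}_{c h}(v)=\arg\min_{v'}\{h(v')+\frac1{2c}\|v'-v\|^2\}$. Given $(z_g^k,y_g^k)$, $a_x^k(x,y)=\nabla_x\hat F(x,y)+\frac{\mu_x}{2}(x-\mu_x^{-1}z_g^k)$ and $a_y^k(x,y)=-\nabla_y\hat F(x,y)+\mu_y y+\theta_y^{-1}(y-y_g^k)$. Algorithm FOAM. Input: $z^0=z_f^0\in\mathbb{R}^{d_x}$,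 $y^0=y_f^0\in\mathbb{R}^{d_y}$. Parameters: $\alpha\in(0,1]$, $\eta_z,\eta_y,\theta_y>0$, $\{\beta_t\}_{t\ge0}\subset(0,1)$, $\lambda,\gamma_x,\gamma_y>0$, $K\in\{1,2,\ldots\}$. For $k=0,\ldots,K-1$: 1. $(z_g^k,y_g^k)=\alpha(z^k,y^k)+(1-\alpha)(z_f^k,y_f^k)$. 2. $(x^{k,-1},y^{k,-1})=(-\mu_x^{-1}z_g^k,y_g^k)$. 3. $x^{k,0}=\mathrm{prox}_{\gamma_x\lambda r}(x^{k,-1}-\gamma_x\lambda a_x^k(x^{k,-1},y^{k,-1}))$, $y^{k,0}=\mathrm{prox}_{\gamma_y\lambda g}(y^{k,-1}-\gamma_y\lambda a_y^k(x^{k,-1},y^{k,-1}))$. 4. $b_x^{k,0}=\frac1{\gamma_x\lambda}(x^{k,-1}-\gamma_x\lambda a_x^k(x^{k,-1},y^{k,-1})-x^{k,0})$, $b_y^{k,0}=\frac1{\gamma_y\lambda}(y^{k,-1}-\gamma_y\lambda a_y^k(x^{k,-1},y^{k,-1})-y^{k,0})$; set $t=0$. 5. While the condition $\gamma_x\|a_x^k(x^{k,t},y^{k,t})+b_x^{k,t}\|^2+\gamma_y\|a_y^k(x^{k,t},y^{k,t})+b_y^{k,t}\|^2\le\gamma_x^{-1}\|x^{k,t}-x^{k,-1}\|^2+\gamma_y^{-1}\|y^{k,t}-y^{k,-1}\|^2$ is not satisfied, do: $x^{k,t+1/2}=x^{k,t}+\beta_t(x^{k,0}-x^{k,t})-\gamma_x\lambda(a_x^k(x^{k,t},y^{k,t})+b_x^{k,t})$;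 $y^{k,t+1/2}=y^{k,t}+\beta_t(y^{k,0}-y^{k,t})-\gamma_y\lambda(a_y^k(x^{k,t},y^{k,t})+b_y^{k,t})$; $x^{k,t+1}=\mathrm{prox}_{\gamma_x\lambda r}(x^{k,t}+\beta_t(x^{k,0}-x^{k,t})-\gamma_x\lambda a_x^k(x^{k,t+1/2},y^{k,t+1/2}))$; $y^{k,t+1}=\mathrm{prox}_{\gamma_y\lambda g}(y^{k,t}+\beta_t(y^{k,0}-y^{k,t})-\gamma_y\lambda a_y^k(x^{k,t+1/2},y^{k,t+1/2}))$; $b_x^{k,t+1}=\frac1{\gamma_x\lambda}(x^{k,t}+\beta_t(x^{k,0}-x^{k,t})-\gamma_x\lambda a_x^k(x^{k,t+1/2},y^{k,t+1/2})-x^{k,t+1})$; $b_y^{k,t+1}=\frac1{\gamma_y\lambda}(y^{k,t}+\beta_t(y^{k,0}-y^{k,t})-\gamma_y\lambda a_y^k(x^{k,t+1/2},y^{k,t+1/2})-y^{k,t+1})$; $t\leftarrow t+1$. 6. $t^k=t$; $(x_f^{k+1},y_f^{k+1})=(x^{k,t^k},y^{k,t^k})$; $z_f^{k+1}=\nabla_x\hat F(x_f^{k+1},y_f^{k+1})+b_x^{k,t^k}$; $w_f^{k+1}=-\nabla_y\hat F(x_f^{k+1},y_f^{k+1})+b_y^{k,t^k}$. 7. $z^{k+1}=z^k+\eta_z\mu_x^{-1}(z_f^{k+1}-z^k)-\eta_z(x_f^{k+1}+\mu_x^{-1}z_f^{k+1})$; $y^{k+1}=y^k+\eta_y\mu_y(y_f^{k+1}-y^k)-\eta_y(w_f^{k+1}+\mu_yy_f^{k+1})$.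 Output: $(-\mu_x^{-1}z^K,y^K)$. Complexity convention. A gradient evaluation is one evaluation of $\nabla F$ (that is, of $\nabla_xF$ and/or $\nabla_yF$) at a point. ''Gradient evaluation complexity $\mathcal{O}(Q\log\frac1\epsilon)$'' means: there are a universal constant $c>0$ and a constant $C\geq 2$, possibly depending on the problem, the parameters and the initial point but not on $\epsilon$, such that for every $\epsilon\in(0,1)$ the number $K$ of outer iterations can be chosen so that the output is an $\epsilon$-accurate solution and the total number of gradient evaluations performed is at most $cQ\log\frac{C}{\epsilon}$. *)

(* Defs.v *)
From HB Require Import structures.
From mathcomp Require Import all_boot all_order all_algebra.
From mathcomp Require Import all_classical all_reals all_analysis.

Set Implicit Arguments.
Unset Strict Implicit.
Unset Printing Implicit Defensive.

Import Order.TTheory GRing.Theory Num.Theory.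
Import numFieldNormedType.Exports.

Local Open Scope classical_set_scope.
Local Open Scope ring_scope.

Section Vectors.
Variables (R : realType) (d : nat).
Implicit Types (x y u v : 'rV[R]_d) (h : 'rV[R]_d -> \bar R).

(* Squared Euclidean norm; the library norm `|x| on row vectors is the sup
   norm, which induces the same topology and differentials. *)
Definition sqnorm x : R := \sum_i x ord0 i ^+ 2.

Definition grad (f : 'rV[R]_d -> R) x : 'rV[R]_d :=
  \row_i 'D_(delta_mx ord0 i) f x.

Definition strongly_convex (mu : R) (f : 'rV[R]_d -> R) : Prop :=
  forall x y (t : R), 0 <= t <= 1 ->
    f (t *: x + (1 - t) *: y) <=
      t * f x + (1 - t) * f y - mu / 2 * (t * (1 - t)) * sqnorm (x - y).

Local Open Scope ereal_scope.

Definition proper h : Prop :=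
  (forall x, h x != -oo) /\ (exists x, h x != +oo).

(* For t = 0 or t = 1 the library convention 0 * +oo = 0 makes the inequality
   trivial. *)
Definition convex_ereal h : Prop :=
  forall x y (t : R), (0 <= t <= 1)%R ->
    h (t *: x + (1 - t) *: y)%R <= t%:E * h x + (1 - t)%:E * h y.

Definition proper_lsc_convex h : Prop :=
  [/\ proper h, lower_semicontinuous h & convex_ereal h].

Definition argmin h : set 'rV[R]_d := [set u | forall v, h u <= h v].

(* prox_{c h}(v); the default 0 is only used when there is no minimizer. *)
Definition prox (c : R) h v : 'rV[R]_d :=
  xget 0%R (argmin (fun u => h u + ((2 * c)^-1 * sqnorm (u - v)%R)%:E)).

End Vectors.

Section Problem.
Variables (R : realType) (dx dy : nat).
Implicit Types (F : 'rV[R]_dx -> 'rV[R]_dy -> R).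
Implicit Types (x : 'rV[R]_dx) (y : 'rV[R]_dy).
Implicit Types (r : 'rV[R]_dx -> \bar R) (g : 'rV[R]_dy -> \bar R).

Definition gradx F x y : 'rV[R]_dx := grad (F ^~ y) x.
Definition grady F x y : 'rV[R]_dy := grad (F x) y.

Definition continuously_differentiable F : Prop :=
  [/\ forall p, differentiable (fun p : 'rV[R]_dx * 'rV[R]_dy => F p.1 p.2) p,
      continuous (fun p : 'rV[R]_dx * 'rV[R]_dy => gradx F p.1 p.2) &
      continuous (fun p : 'rV[R]_dx * 'rV[R]_dy => grady F p.1 p.2)].

Definition smooth (L : R) F : Prop := forall x1 x2 y1 y2,
  sqnorm (gradx F x1 y1 - gradx F x2 y2)
    + sqnorm (grady F x1 y1 - grady F x2 y2)
  <= L ^+ 2 * (sqnorm (x1 - x2) + sqnorm (y1 - y2)).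

Section Solution.
Local Open Scope ereal_scope.

(* With the library convention +oo - +oo = -oo, the value is -oo where g = +oo,
   whatever r is; as g is proper, this leaves the supremum over y equal to +oo
   at every x with r x = +oo. *)
Definition objective F r g x y : \bar R := r x + (F x y)%:E - g y.

(* A solution of min_x max_y (r x + F x y - g y), of finite value. *)
Definition minimax_solution F r g xs ys : Prop :=
  [/\ objective F r g xs ys \is a fin_num,
      forall x, ereal_sup (range (objective F r g xs))
                  <= ereal_sup (range (objective F r g x)) &
      forall y, objective F r g xs y <= objective F r g xs ys].

End Solution.

Definition accurate (eps : R) xs ys (p : 'rV[R]_dx * 'rV[R]_dy) : Prop :=
  sqnorm (p.1 - xs) + sqnorm (p.2 - ys) <= eps.

End Problem.

Record foam_params (R : realType) := FoamParams {
  alpha : R; eta_z : R; eta_y : R; theta_y : R; beta : nat -> R;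
  lambda : R; gamma_x : R; gamma_y : R }.

Record inner_state (R : realType) (dx dy : nat) := InnerState {
  in_x : 'rV[R]_dx; in_y : 'rV[R]_dy;
  in_bx : 'rV[R]_dx; in_by : 'rV[R]_dy }.

Record outer_state (R : realType) (dx dy : nat) := OuterState {
  out_z : 'rV[R]_dx; out_y : 'rV[R]_dy;
  out_zf : 'rV[R]_dx; out_yf : 'rV[R]_dy;
  out_evals : nat (* gradient evaluations performed so far *) }.

Section Foam.
Variables (R : realType) (dx dy : nat).
Variables (F : 'rV[R]_dx -> 'rV[R]_dy -> R).
Variables (r : 'rV[R]_dx -> \bar R) (g : 'rV[R]_dy -> \bar R).
Variables (mux muy : R) (P : foam_params R).

Local Notation istate := (inner_state R dx dy).
Local Notation ostate := (outer_state R dx dy).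

Definition Fhat (x : 'rV[R]_dx) (y : 'rV[R]_dy) : R :=
  F x y - mux / 2 * sqnorm x + muy / 2 * sqnorm y.

Section Inner.
Variables (zg : 'rV[R]_dx) (yg : 'rV[R]_dy).

Definition ax (x : 'rV[R]_dx) (y : 'rV[R]_dy) : 'rV[R]_dx :=
  gradx Fhat x y + (mux / 2) *: (x - mux^-1 *: zg).

Definition ay (x : 'rV[R]_dx) (y : 'rV[R]_dy) : 'rV[R]_dy :=
  - grady Fhat x y + muy *: y + (theta_y P)^-1 *: (y - yg).

(* Forward-backward step from (px, py), with the operator evaluated at
   (qx, qy). *)
Definition fb_step (px : 'rV[R]_dx) (py : 'rV[R]_dy)
    (qx : 'rV[R]_dx) (qy : 'rV[R]_dy) : istate :=
  let cx := gamma_x P * lambda P in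
  let cy := gamma_y P * lambda P in
  let vx := px - cx *: ax qx qy in
  let vy := py - cy *: ay qx qy in
  let x' := prox cx r vx in
  let y' := prox cy g vy in
  InnerState x' y' (cx^-1 *: (vx - x')) (cy^-1 *: (vy - y')).

(* (x^{k,-1}, y^{k,-1}) *)
Definition xm1 : 'rV[R]_dx := - (mux^-1 *: zg).
Definition ym1 : 'rV[R]_dy := yg.

Definition inner_init : istate := fb_step xm1 ym1 xm1 ym1.

Definition inner_step (t : nat) (s : istate) : istate :=
  let x := in_x s in
  let y := in_y s in
  let px := x + beta P t *: (in_x inner_init - x) in
  let py := y + beta P t *: (in_y inner_init - y) in
  let xh := px - (gamma_x P * lambda P) *: (ax x y + in_bx s) in
  let yh := py - (gamma_y P * lambda P) *: (ay x y + in_by s) in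
  fb_step px py xh yh.

Fixpoint inner (t : nat) : istate :=
  if t is t'.+1 then inner_step t' (inner t') else inner_init.

Definition stop (s : istate) : bool :=
  gamma_x P * sqnorm (ax (in_x s) (in_y s) + in_bx s)
    + gamma_y P * sqnorm (ay (in_x s) (in_y s) + in_by s)
  <= (gamma_x P)^-1 * sqnorm (in_x s - xm1)
     + (gamma_y P)^-1 * sqnorm (in_y s - ym1).

(* t^k, or None when the while loop does not terminate. *)
Definition inner_count : option nat :=
  if pselect (exists t, stop (inner t)) is left stops
  then Some (ex_minn stops) else None.

End Inner.

(* Gradient evaluations of an outer iteration whose while loop makes t passes,
   nothing being reused from one formula to the next: one for inner_init, one
   for each of the t + 1 tests, two for each pass and one for the final
   z_f, w_f. *)
Definition outer_evals (t : nat) : nat := (1 + t.+1 + 2 * t + 1)%N.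

Definition outer_step (s : ostate) : option ostate :=
  let zg := alpha P *: out_z s + (1 - alpha P) *: out_zf s in
  let yg := alpha P *: out_y s + (1 - alpha P) *: out_yf s in
  if inner_count zg yg is Some t then
    let i := inner zg yg t in
    let xf := in_x i in
    let yf := in_y i in
    let zf := gradx Fhat xf yf + in_bx i in
    let wf := - grady Fhat xf yf + in_by i in
    let z := out_z s + (eta_z P * mux^-1) *: (zf - out_z s)
               - eta_z P *: (xf + mux^-1 *: zf) in
    let y := out_y s + (eta_y P * muy) *: (yf - out_y s)
               - eta_y P *: (wf + muy *: yf) in
    Some (OuterState z y zf yf (out_evals s + outer_evals t)%N)
  else None.

(* State after K outer iterations, or None when some while loop does not
   terminate. *)
Definition foam (z0 : 'rV[R]_dx) (y0 : 'rV[R]_dy) (K : nat) : option ostate :=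
  iter K (obind outer_step) (Some (OuterState z0 y0 z0 y0 0)).

Definition foam_output (s : ostate) : 'rV[R]_dx * 'rV[R]_dy :=
  (- (mux^-1 *: out_z s), out_y s).

End Foam.

Definition tuned_params (R : realType) (mux muy L : R) : foam_params R :=
  let theta := 8 * mux^-1 in
  let al := Num.min 1 (Num.sqrt (theta * muy)) in
  {| alpha := al;
     eta_z := mux / 2;
     eta_y := Num.min (2 * muy)^-1 (theta / (2 * al));
     theta_y := theta;
     beta := fun t => 2 / (t%:R + 3);
     lambda := (2 * Num.sqrt 5 * (1 + 8 * L / mux))^-1;
     gamma_x := 8 * mux^-1;
     gamma_y := theta |}.

(* Main.v *)
Require Import Defs.
From mathcomp Require Import all_boot all_order all_algebra.
From mathcomp Require Import all_classical all_reals all_analysis.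
From mathcomp Require Import ring lra.

Set Implicit Arguments.
Unset Strict Implicit.
Unset Printing Implicit Defensive.

Import Order.TTheory GRing.Theory Num.Theory.
Import numFieldNormedType.Exports.

Local Open Scope classical_set_scope.
Local Open Scope ring_scope.

(** The minimax problem is turned into the minimization of a strongly convex
    function and solved by an accelerated inexact proximal point method.
    Write F^ = [Fhat F mux muy], convex in x and concave in y. Exchanging the
    minimum over x with the maximum over y, the problem is equivalent to
    minimizing over (z, y)

      P (z, y) = |z|^2 / (2 mux) + muy |y|^2 / 2 + G (z, y),
      G (z, y) = sup over x of <x, z> - r x - F^ (x, y) + g y,

    where G is convex, being a supremum of convex functions of (z, y). The
    minimizer is (- mux xs, ys), and (x, w) is a subgradient of G at (z, y)
    exactly when z - grad_x F^ is a subgradient of r at x and w + grad_y F^ a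
    subgradient of g at y. The supremum is never formed: [dual_value] is the
    value of P at a point z, y for which such an x is at hand, and
    [dual_value_ge] is the strong convexity inequality of P between two such
    points.

    Outer loop. A pass is an inexact proximal step of P at (zg, yg), with step
    mux in z and 8 / mux in y, followed by an extrapolation. The stopping test
    is what makes the inexact step as good as an exact one
    ([stop_bracket_le]). Hence the sum of the squared distances of (z, y) to the
    solution, suitably weighted, and of the gap of P at (zf, yf) shrinks by the
    factor 1 - alpha / 2 at every pass ([outer_step_contracts]), and alpha is
    at least sqrt (muy / mux) when muy <= mux. The gap may be infinite at the
    initial point, since y0 need not be in the domain of g; it is finite after one pass,
    and the rate is measured from there.

    Inner loop. The proximal subproblem asks for a zero of the sum of a monotone
    Lipschitz operator A = (ax, ay) and of the subdifferentials of r and g. The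
    loop is an extragradient method whose iterates are pulled back towards its
    first point p_0. A potential combining the squared residual with its inner
    product with p_t - p_0 decreases ([anchored_potential_decreasing]), so the
    residual is O(1 / t) times the distance from p_0 to p_t, up to a term in the
    first residual. Both p_0 - p_t and the first residual are bounded by
    p_t - p_(-1) and the residual of p_t, because a proximal map is
    nonexpansive. So the residual at t is O(1 / t) times |p_t - p_(-1)|, the
    very quantity of the stopping test, and the estimate involves the iterates
    only, not a zero of the subproblem. The test thus holds for some
    t = O(1 / lambda) = O(L / mux) ([inner_loop_terminates]).

    Together, O(sqrt (mux / muy) log (C / eps)) outer passes of O(L / mux)
    gradient evaluations each give the claim.

    Two facts on which all of this rests are proved beforehand. The proximal
    points exist ([argmin_prox_nonempty]), as a convex lower semicontinuous
    function decreases at most linearly at infinity. And a minimax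
    solution satisfies the first-order conditions in x and y, which for x is a
    statement about the derivative of a supremum ([minimax_subgradient_x]). *)

(** * Euclidean geometry of row vectors *)

Section Euclid.
Variables (R : realType) (d : nat).
Implicit Types (x y z : 'rV[R]_d) (a : R).

Definition dot x y : R := \sum_i x ord0 i * y ord0 i.

Definition enorm x : R := Num.sqrt (sqnorm x).

Lemma sqnormE x : sqnorm x = dot x x.
Proof. by apply: eq_bigr => i _; rewrite expr2. Qed.

Lemma dotC x y : dot x y = dot y x.
Proof. by apply: eq_bigr => i _; rewrite mulrC. Qed.

Lemma dotDl x y z : dot (x + y) z = dot x z + dot y z.
Proof. by rewrite -big_split; apply: eq_bigr => i _; rewrite mxE mulrDl. Qed.

Lemma dotZl a x y : dot (a *: x) y = a * dot x y.
Proof. by rewrite mulr_sumr; apply: eq_bigr => i _; rewrite mxE mulrA. Qed.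

Lemma dotNl x y : dot (- x) y = - dot x y.
Proof. by rewrite -scaleN1r dotZl mulN1r. Qed.

Lemma dotDr x y z : dot x (y + z) = dot x y + dot x z.
Proof. by rewrite dotC dotDl !(dotC x). Qed.

Lemma dotZr a x y : dot x (a *: y) = a * dot x y.
Proof. by rewrite dotC dotZl dotC. Qed.

Lemma dotNr x y : dot x (- y) = - dot x y.
Proof. by rewrite dotC dotNl dotC. Qed.

Definition dotE := (dotDl, dotDr, dotNl, dotNr, dotZl, dotZr).

Lemma sqnorm_ge0 x : 0 <= sqnorm x.
Proof. by apply: sumr_ge0 => i _; exact: sqr_ge0. Qed.

Lemma dot_ge0 x : 0 <= dot x x.
Proof. by rewrite -sqnormE sqnorm_ge0. Qed.

Lemma dot0l x : dot 0 x = 0.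
Proof. by rewrite -(scale0r (0 : 'rV[R]_d)) dotZl mul0r. Qed.

Lemma sqnorm0 : sqnorm (0 : 'rV[R]_d) = 0.
Proof. by rewrite sqnormE dot0l. Qed.

Lemma sqnormZ a x : sqnorm (a *: x) = a ^+ 2 * sqnorm x.
Proof. by rewrite !sqnormE !dotE mulrA expr2. Qed.

Lemma sqnormN x : sqnorm (- x) = sqnorm x.
Proof. by rewrite !sqnormE !dotE opprK. Qed.

Lemma sqnormBC x y : sqnorm (x - y) = sqnorm (y - x).
Proof. by rewrite -sqnormN opprB. Qed.

Lemma enorm_ge0 x : 0 <= enorm x.
Proof. exact: sqrtr_ge0. Qed.

Lemma sqr_enorm x : enorm x ^+ 2 = sqnorm x.
Proof. by rewrite sqr_sqrtr ?sqnorm_ge0. Qed.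

Lemma ler_enorm x a : 0 <= a -> (enorm x <= a) = (sqnorm x <= a ^+ 2).
Proof.
by move=> a0; rewrite -sqr_enorm ler_pXn2r // nnegrE ?enorm_ge0.
Qed.

Lemma enormZ a x : enorm (a *: x) = `|a| * enorm x.
Proof. by rewrite /enorm sqnormZ sqrtrM ?sqr_ge0// sqrtr_sqr. Qed.

Lemma enormN x : enorm (- x) = enorm x.
Proof. by rewrite /enorm sqnormN. Qed.

Lemma enormBC x y : enorm (x - y) = enorm (y - x).
Proof. by rewrite /enorm sqnormBC. Qed.

Lemma sqnorm_eq0 x : sqnorm x = 0 -> x = 0.
Proof.
move=> x0; apply/rowP => i; rewrite mxE; apply/eqP; rewrite -sqrf_eq0.
have := x0; move/eqP; rewrite psumr_eq0; last by move=> j _; exact: sqr_ge0.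
by move/allP/(_ i (mem_index_enum i)).
Qed.

Lemma cauchy_schwarz x y : dot x y <= enorm x * enorm y.
Proof.
have [x0|x0] := eqVneq (sqnorm x) 0.
  by rewrite (sqnorm_eq0 x0) dot0l mulr_ge0 ?enorm_ge0.
have {x0} xgt0 : 0 < sqnorm x by rewrite lt_neqAle eq_sym x0 sqnorm_ge0.
have := sqnorm_ge0 (sqnorm x *: y - dot x y *: x).
have -> : sqnorm (sqnorm x *: y - dot x y *: x) =
    sqnorm x * (sqnorm x * sqnorm y - dot x y ^+ 2).
  by rewrite !sqnormE !dotE (dotC y x); ring.
rewrite pmulr_rge0// subr_ge0 -!sqr_enorm -exprMn => xy.
apply: le_trans (ler_norm _) _.
by rewrite -ler_sqr ?nnegrE ?mulr_ge0 ?enorm_ge0// real_normK ?num_real.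
Qed.

Lemma enormD x y : enorm (x + y) <= enorm x + enorm y.
Proof.
rewrite ler_enorm ?addr_ge0 ?enorm_ge0// sqrrD !sqr_enorm !sqnormE !dotE.
by rewrite (dotC y x); have := cauchy_schwarz x y; lra.
Qed.

Lemma enormB x y : enorm (x - y) <= enorm x + enorm y.
Proof. by rewrite -(enormN y) enormD. Qed.

End Euclid.

Section RowMx.
Variables (R : realType) (d1 d2 : nat).

Lemma dot_row_mx (x1 x2 : 'rV[R]_d1) (y1 y2 : 'rV[R]_d2) :
  dot (row_mx x1 y1) (row_mx x2 y2) = dot x1 x2 + dot y1 y2.
Proof.
rewrite /dot big_split_ord /=.
by congr (_ + _); apply: eq_bigr => i _; rewrite ?row_mxEl ?row_mxEr.
Qed.

Lemma sqnorm_row_mx (x : 'rV[R]_d1) (y : 'rV[R]_d2) :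
  sqnorm (row_mx x y) = sqnorm x + sqnorm y.
Proof. by rewrite !sqnormE dot_row_mx. Qed.

End RowMx.

(** * Anchored extragradient iterations *)

Section AnchoredExtragradient.
Variables (R : realType) (d : nat).
Variables (A : 'rV[R]_d -> 'rV[R]_d) (s M : R).
Variables (pm : 'rV[R]_d) (p q b : nat -> 'rV[R]_d).

Let res t := A (p t) + b t.

Hypothesis s_gt0 : 0 < s.
Hypothesis M_ge0 : 0 <= M.
Hypothesis sM : s * M <= 3 / 10.
Hypothesis A_lip : forall u v, enorm (A u - A v) <= M * enorm (u - v).
Hypothesis A_mono : forall u v, 0 <= dot (A u - A v) (u - v).
Hypothesis b_mono : forall i j, 0 <= dot (b i - b j) (p i - p j).
Hypothesis p0E : p 0%N = pm - s *: A pm - s *: b 0%N.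
Hypothesis qE : forall t,
  q t = p t + (2 / (t%:R + 3)) *: (p 0%N - p t) - s *: res t.
Hypothesis pE : forall t, p t.+1 =
  p t + (2 / (t%:R + 3)) *: (p 0%N - p t) - s *: (A (q t) + b t.+1).

Let potential t :=
  s * ((t%:R + 1) * (t%:R + 2) * (t%:R + 3) / 4) * sqnorm (res t)
  - (t%:R + 1) * (t%:R + 2) * dot (res t) (p 0%N - p t).

(** The drop of the potential is a sum of squares, plus c times the monotonicity
    of A and of the b's between p_t and p_(t+1), plus s tau times the Lipschitz
    bound on A between q_t and p_(t+1). The weight c is the one that cancels the
    inner products with p_0 - p_t. As (s M)^2 <= 1/5, the weight tau leaves the
    squares |r' - 2 rt|^2 and |r - rt|^2 with nonnegative coefficients for all
    t >= 0, where r, r', rt are the residuals at p_t, p_(t+1) and at the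
    extrapolated point; at t = 0 the constant 1/5 is sharp for this choice. *)
Lemma anchored_potential_decreasing t : potential t.+1 <= potential t.
Proof.
set n : R := t%:R.
have n_ge0 : 0 <= n by rewrite ler0n.
have n3 : n + 3 != 0 by apply: lt0r_neq0; lra.
set r := res t; set r' := res t.+1; set rt := A (q t) + b t.+1.
set e := p 0%N - p t.
have dpE : p t.+1 - p t = (2 / (n + 3)) *: e - s *: rt.
  by rewrite pE -/e -/rt; apply/rowP => i; rewrite !mxE; ring.
have eE : p 0%N - p t.+1 = ((n + 1) / (n + 3)) *: e + s *: rt.
  rewrite pE -/e -/rt /e; apply/rowP => i; rewrite !mxE.
  by rewrite -/n; field.
have qpE : p t.+1 - q t = s *: (r - rt).
  by rewrite pE -/rt qE -/r; apply/rowP => i; rewrite !mxE; ring.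
have mono : 0 <= dot (r' - r) ((2 / (n + 3)) *: e - s *: rt).
  rewrite -dpE (_ : r' - r = A (p t.+1) - A (p t) + (b t.+1 - b t)).
    by rewrite dotDl addr_ge0.
  by rewrite /r' /r /res; apply/rowP => i; rewrite !mxE; ring.
have lip : sqnorm (r' - rt) <= sqnorm (r - rt) / 5.
  have -> : r' - rt = A (p t.+1) - A (q t).
    by rewrite /r' /rt /res; apply/rowP => i; rewrite !mxE; ring.
  have := A_lip (p t.+1) (q t); rewrite qpE enormZ gtr0_norm// => h.
  have h1 : enorm (A (p t.+1) - A (q t)) <= 3 / 10 * enorm (r - rt).
    apply: le_trans h _; rewrite mulrA (mulrC M).
    by rewrite ler_wpM2r ?enorm_ge0.
  rewrite -!sqr_enorm.
  have := enorm_ge0 (r - rt); have := enorm_ge0 (A (p t.+1) - A (q t)).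
  by nra.
rewrite -subr_ge0.
pose c := (n + 1) * (n + 2) * (n + 3) / 2.
pose tau := (n + 2) * (n + 3) * (n + 5) / 4.
have -> : potential t - potential t.+1 =
    s * ((n + 2) * (n + 3) / 4)
      * (sqnorm (r' - 2 *: rt) + (4 * n / 5) * sqnorm (r - rt))
    + c * dot (r' - r) ((2 / (n + 3)) *: e - s *: rt)
    + s * tau * (sqnorm (r - rt) / 5 - sqnorm (r' - rt)).
  rewrite /potential -/r -/r' eE -/e -[t.+1%:R]natr1 -/n.
  clear mono lip dpE eE qpE; clearbody r r' rt e.
  rewrite !sqnormE !dotE (dotC rt r') (dotC rt r) /c /tau.
  by field.
have k0 : 0 <= (n + 2) * (n + 3) / 4 by nra.
apply: addr_ge0; first apply: addr_ge0.
- apply: mulr_ge0; first by rewrite mulr_ge0// ltW.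
  by rewrite addr_ge0 ?sqnorm_ge0// mulr_ge0 ?sqnorm_ge0//; lra.
- by rewrite mulr_ge0// /c divr_ge0// mulr_ge0 ?mulr_ge0//; lra.
- rewrite mulr_ge0 ?subr_ge0// mulr_ge0 ?(ltW s_gt0)// /tau.
  by rewrite divr_ge0// mulr_ge0 ?mulr_ge0//; lra.
Qed.

Lemma anchored_potential_le0 t : potential t <= potential 0%N.
Proof.
by elim: t => // t; exact: le_trans (anchored_potential_decreasing t).
Qed.

Lemma anchor_residual_le :
  s * enorm (res 0%N) <= 13 / 10 * enorm (p 0%N - pm).
Proof.
have -> : s * enorm (res 0%N) = enorm (s *: (A (p 0%N) - A pm) - (p 0%N - pm)).
  rewrite -[s in LHS]gtr0_norm// -enormZ; congr enorm.
  by rewrite {2}p0E /res; apply/rowP => i; rewrite !mxE; ring.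
apply: le_trans (enormB _ _) _; rewrite enormZ gtr0_norm//.
have := ler_wpM2l (ltW s_gt0) (A_lip (p 0%N) pm).
have := ler_wpM2r (enorm_ge0 (p 0%N - pm)) sM.
by lra.
Qed.

(** Both p_0 and p_t are proximal points, of pm - s A pm and of
    p_t - s A p_t + s r_t, and the map is nonexpansive: this is the monotonicity
    of the b's. *)
Lemma anchor_dist_le t :
  enorm (p 0%N - p t) <= 13 / 10 * enorm (p t - pm) + s * enorm (res t).
Proof.
have := b_mono 0%N t.
pose v := pm - p t - s *: (A pm - A (p t)) - s *: res t.
have vE : p 0%N - p t + s *: (b 0%N - b t) = v.
  by rewrite p0E /v /res; apply/rowP => i; rewrite !mxE; ring.
rewrite dotC => mono.
have h : enorm (p 0%N - p t) <= enorm v.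
  rewrite ler_enorm ?enorm_ge0// sqr_enorm -vE !sqnormE.
  move: (p 0%N - p t) (b 0%N - b t) mono => x y mono.
  rewrite !dotE (dotC y x).
  have := mulr_ge0 (ltW s_gt0) mono.
  by have := mulr_ge0 (mulr_ge0 (ltW s_gt0) (ltW s_gt0)) (dot_ge0 y); lra.
apply: le_trans h _; apply: le_trans (enormB _ _) _.
rewrite (enormZ s (res t)) gtr0_norm// lerD2r.
apply: le_trans (enormB _ _) _; rewrite enormZ gtr0_norm// (enormBC pm).
have := ler_wpM2l (ltW s_gt0) (A_lip pm (p t)).
rewrite (enormBC pm).
have := ler_wpM2r (enorm_ge0 (p t - pm)) sM.
by lra.
Qed.

(** The decrease of the potential bounds the residual by the distance from p_0
    to p_t, which [anchor_dist_le] in turn bounds by |p_t - pm| and the residual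
    itself. For l t >= 8 the residual enters the right-hand side with a factor
    small enough to be absorbed on the left. *)
Lemma anchored_residual_le t (l : R) : 0 < l -> l <= 1 / 40 -> 8 <= l * t%:R ->
  s * enorm (res t) <= l * enorm (p t - pm).
Proof.
move=> l_gt0 l_le lt.
set D := enorm (p t - pm); set rho := s * enorm (res t).
have D_ge0 : 0 <= D by exact: enorm_ge0.
have rho_ge0 : 0 <= rho by rewrite mulr_ge0 ?(ltW s_gt0) ?enorm_ge0.
have n_ge0 : 0 <= t%:R :> R by rewrite ler0n.
have := anchor_dist_le t; rewrite -/D -/rho; set E := enorm (p 0%N - p t) => hE.
have E_ge0 : 0 <= E by exact: enorm_ge0.
have := anchored_potential_le0 t; rewrite /potential subrr mulr0n.
have -> : dot (res 0) 0 = 0 by rewrite dotC dot0l.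
rewrite -!sqr_enorm => hV.
have h0 : s * enorm (res 0%N) <= 13 / 10 * (23 / 10 * D + rho).
  apply: le_trans anchor_residual_le _.
  have -> : p 0%N - pm = (p 0%N - p t) + (p t - pm).
    by apply/rowP => i; rewrite !mxE; ring.
  by have := enormD (p 0%N - p t) (p t - pm); rewrite -/E -/D; lra.
have hdot := cauchy_schwarz (res t) (p 0%N - p t).
rewrite -/E in hdot.
rewrite leNgt; apply/negP => rho_gt.
have rho_pos : 0 < rho by apply: le_lt_trans rho_gt; rewrite mulr_ge0// ltW.
(* Multiplying the potential bound by s leaves an inequality between the
   lengths rho, D and E only. *)
set n : R := t%:R in lt n_ge0 hV.
set B := (n + 1) * (n + 2).
have B_gt0 : 0 < B by rewrite mulr_gt0//; lra.
have key : B * (n + 3) / 4 * rho ^+ 2 <=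
    3 / 2 * (13 / 10 * (23 / 10 * D + rho)) ^+ 2 + B * (rho * E).
  have h1 : (s * enorm (res 0%N)) ^+ 2 <=
      (13 / 10 * (23 / 10 * D + rho)) ^+ 2.
    by rewrite lerXn2r// nnegrE ?mulr_ge0 ?(ltW s_gt0) ?enorm_ge0//; lra.
  have h2 : B * (s * dot (res t) (p 0%N - p t)) <= B * (rho * E).
    rewrite ler_pM2l// /rho -mulrA ler_pM2l//.
  have h3 := ler_wpM2l (ltW s_gt0) hV.
  have h4 : rho ^+ 2 = s * (s * enorm (res t) ^+ 2) by rewrite /rho; ring.
  rewrite h4; move: h1 h2 h3; rewrite exprMn; clearbody rho; rewrite /B.
  move: (enorm _ ^+ 2) (enorm _ ^+ 2) (dot _ _) => *; lra.
pose Y := rho / l.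
have lY : l * Y = rho by rewrite /Y mulrC divfK// gt_eqF.
have Y_gt0 : 0 < Y by rewrite /Y divr_gt0.
have DY : D <= Y by rewrite /Y ler_pdivlMr// mulrC ltW.
clear hV h0 hdot; clearbody n rho Y D E.
have rhoY : 40 * rho <= Y by rewrite -lY; nra.
have nrho : 8 * Y <= n * rho by rewrite -lY mulrA ler_pM2r// mulrC.
have h1 : (13 / 10 * (23 / 10 * D + rho)) ^+ 2 <= (39 / 12 * Y) ^+ 2.
  by rewrite lerXn2r// ?nnegrE; lra.
have h2 : B * (rho * E) <= B * (rho * (7 / 5 * Y)).
  by rewrite ler_pM2l// ler_pM2l//; lra.
have h3 : B * rho * (2 * Y) <= B * (n + 3) / 4 * rho ^+ 2.
  have -> : B * (n + 3) / 4 * rho ^+ 2 = B * rho * ((n * rho + 3 * rho) / 4).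
    by field.
  by rewrite ler_pM2l ?mulr_gt0//; lra.
have h4 : 64 * Y ^+ 2 <= B * rho ^+ 2.
  have : (8 * Y) ^+ 2 <= (n * rho) ^+ 2 by rewrite lerXn2r// nnegrE; nra.
  have : 0 <= (3 * n + 2) * rho ^+ 2 by rewrite mulr_ge0 ?sqr_ge0//; lra.
  by rewrite /B; lra.
have Br_gt0 : 0 < B * rho by exact: mulr_gt0.
have h5 : B * rho * (40 * rho) <= B * rho * Y by rewrite ler_pM2l.
have h6 : 0 < B * rho * Y by exact: mulr_gt0.
lra.
Qed.

End AnchoredExtragradient.

(** * Subgradients and proximal points *)

Lemma ereal_between (R : realType) (x y : \bar R) :
  (x < y)%E -> exists a : R, (x < a%:E < y)%E.
Proof.
case: x => [x| |]; case: y => [y| |]//=.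
- rewrite lte_fin => xy; exists ((x + y) / 2); rewrite !lte_fin; lra.
- by move=> _; exists (x + 1); rewrite lte_fin ltry andbT; lra.
- by move=> _; exists (y - 1); rewrite lte_fin ltNyr /=; lra.
- by move=> _; exists 0; rewrite ltNyr ltry.
Qed.

(** The sublevel sets of f above its infimum on K generate a filter on K; at a
    cluster point, semicontinuity forces the value to be the infimum. *)
Lemma lower_semicontinuous_min (R : realType) (X : topologicalType)
    (f : X -> \bar R) (K : set X) :
  compact K -> K !=set0 -> lower_semicontinuous f ->
  exists2 u, K u & forall v, K v -> (f u <= f v)%E.
Proof.
move=> Kc [x0 Kx0] lscf.
set m := ereal_inf (f @` K).
have mle v : K v -> (m <= f v)%E by move=> Kv; apply: ereal_inf_lbound; exists v.
have [moo|mfin] := eqVneq m +oo%E.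
  by exists x0 => // v /mle; rewrite moo leye_eq => /eqP ->; rewrite leey.
have [a0 ma0] : exists a : R, (m < a%:E)%E.
  have : (m < +oo)%E by rewrite ltey.
  by move=> /ereal_between[a /andP[ma _]]; exists a.
pose B (a : R) := K `&` [set v | (f v < a%:E)%E].
pose D := [set a : R | (m < a%:E)%E].
have FF : ProperFilter (filter_from D B).
  apply: filter_from_proper; last first.
    by move=> a /ereal_inf_lt[_ [v Kv <-] fva]; exists v.
  apply: filter_from_filter; first by exists a0.
  move=> a b Da Db; exists (Num.min a b).
    by rewrite /D /= /Num.min; case: ifP.
  move=> v [Kv]; rewrite /= EFin_min lt_min => /andP[va vb].
  by split; split.
have FK : filter_from D B K by exists a0 => // v [].
have [p [Kp clp]] := Kc _ FF FK.
exists p => // v /mle; apply: le_trans; rewrite leNgt; apply/negP.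
move=> /ereal_between[a /andP[ma afp]].
have [V Vp fV] := lscf _ _ afp.
have FB : filter_from D B (B a) by exists a.
have [w [[_ /= wa] /fV aw]] := clp _ _ FB Vp.
by move: (lt_trans wa aw); rewrite ltxx.
Qed.

Section Subgradient.
Variables (R : realType) (d : nat).
Implicit Types (h : 'rV[R]_d -> \bar R) (u v w b q : 'rV[R]_d).

Definition subgradient h u b : Prop :=
  h u \is a fin_num /\ forall w, (h u + (dot b (w - u)%R)%:E <= h w)%E.

Lemma subgradient_le h u b w : subgradient h u b -> h w \is a fin_num ->
  fine (h u) + dot b (w - u) <= fine (h w).
Proof.
move=> [hu /(_ w)] + hw; rewrite -{1}(fineK hu) -{1}(fineK hw).
by rewrite -EFinD lee_fin.
Qed.

Lemma subgradient_monotone h u v b c : subgradient h u b -> subgradient h v c ->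
  0 <= dot (b - c) (u - v).
Proof.
move=> ub vc; have := subgradient_le ub vc.1; have := subgradient_le vc ub.1.
by rewrite !dotE; lra.
Qed.

Lemma le0_of_le_linear (a K : R) :
  (forall t, 0 < t <= 1 -> a <= t * K) -> a <= 0.
Proof.
move=> H; rewrite leNgt; apply/negP => a_gt0.
have K_gt0 : 0 < K by have := H 1; rewrite mul1r; lra.
have K2 : 0 < 2 * K + a by lra.
have t01 : 0 < a / (2 * K + a) <= 1 by rewrite divr_gt0//= ler_pdivrMr//; lra.
by have := H _ t01; rewrite mulrAC ler_pdivlMr//; nra.
Qed.

(** First-order condition for minimizing h plus a function that is
    differentiable at u with gradient q, the smooth part being controlled only
    along segments issued from u, up to an error quadratic in t whose constant
    may depend on the segment. Convexity of h and the limit t -> 0 remove the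
    error. *)
Lemma subgradient_of_quadratic_bound h u q :
  proper_lsc_convex h -> h u \is a fin_num ->
  (forall w, h w \is a fin_num -> exists K, forall t, 0 < t <= 1 ->
     (h u <= h (u + t *: (w - u))%R + (t * dot q (w - u) + t ^+ 2 * K)%:E)%E) ->
  subgradient h u (- q).
Proof.
move=> [[hNy _] _ hconv] hu H; split=> // w.
have [hwy|hwy] := eqVneq (h w) +oo%E; first by rewrite hwy leey.
have hw : h w \is a fin_num by rewrite fin_numE hNy hwy.
have [K HK] := H w hw.
have huE := fineK hu; have hwE := fineK hw.
move: (fine (h u)) (fine (h w)) huE hwE => fu fw huE hwE.
rewrite -huE -hwE -EFinD lee_fin dotNl.
rewrite -subr_le0; apply: (@le0_of_le_linear _ K) => t t01.
have := HK t t01; have := hconv w u t; have /andP[t0 t1] := t01.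
rewrite (ltW t0) t1 => /(_ isT).
rewrite (_ : t *: w + _ = u + t *: (w - u)); last first.
  by apply/rowP => i; rewrite !mxE; ring.
rewrite -huE -hwE -!EFinM -EFinD => h1 h2.
have := le_trans h2 (leeD2r _ h1).
rewrite -EFinD lee_fin.
by move=> h3; rewrite -(ler_pM2l t0); lra.
Qed.

Lemma sqnorm_continuous v : continuous (fun u => sqnorm (u - v)).
Proof.
apply: continuous_big; first exact: add_continuous.
move=> i _ u; under eq_fun do rewrite !mxE expr2.
have c : {for u, continuous (fun u : 'rV[R]_d => u ord0 i - v ord0 i)}.
  apply: (@continuousB R R^o _ (fun w : 'rV[R]_d => w ord0 i)).
    exact: (@coord_continuous R 1 d ord0 i u).
  exact: cst_continuous.
exact: (cvgM c c).
Qed.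

Lemma box_compact u (a : R) :
  compact [set v : 'rV[R]_d | forall i, v ord0 i \in `[u ord0 i - a, u ord0 i + a]].
Proof.
by apply: (@rV_compact _ _ (fun i => [set` `[u ord0 i - a, u ord0 i + a]])) => i;
  exact: segment_compact.
Qed.

Lemma coord_le_enorm v i : `|v ord0 i| <= enorm v.
Proof.
rewrite -sqrtr_sqr ler_sqrt ?sqnorm_ge0// /sqnorm (bigD1 i)//=.
by rewrite lerDl sumr_ge0// => j _; exact: sqr_ge0.
Qed.

Lemma in_box u v (a : R) : enorm (v - u) <= a ->
  forall i, v ord0 i \in `[u ord0 i - a, u ord0 i + a].
Proof.
move=> vu i; rewrite in_itv/=; have := coord_le_enorm (v - u) i.
by rewrite !mxE ler_norml => /andP[]; lra.
Qed.

(** h is bounded below near a point u0 of its domain, by semicontinuity and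
    compactness; convexity along rays from u0 extends the bound, with a linear
    loss in the distance. *)
Lemma proper_lsc_convex_lower_bound h : proper_lsc_convex h ->
  exists (u0 : 'rV[R]_d) (k : R), h u0 \is a fin_num /\
    forall u, 1 <= enorm (u - u0) ->
      ((fine (h u0) - k * enorm (u - u0))%:E <= h u)%E.
Proof.
move=> [[hNy [u0 hu0y]] lsc hconv].
have hu0 : h u0 \is a fin_num by rewrite fin_numE hNy hu0y.
have [|m /= Km mmin] := lower_semicontinuous_min (@box_compact u0 1) _ lsc.
  by exists u0; apply: in_box; rewrite subrr /enorm sqnorm0 sqrtr0.
have mu0 : (h m <= h u0)%E.
  by apply: mmin; apply: in_box; rewrite subrr /enorm sqnorm0 sqrtr0.
have hm : h m \is a fin_num.
  by rewrite fin_numE hNy /=; apply: contra_neq hu0y => hmy;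
    move: mu0; rewrite hmy leye_eq => /eqP.
exists u0, (fine (h u0) - fine (h m)); split=> // u.
have hu0E := fineK hu0; have hmE := fineK hm.
move: (fine (h u0)) (fine (h m)) hu0E hmE => fu0 fm hu0E hmE.
set rho := enorm _ => rho1.
have [huy|huy] := eqVneq (h u) +oo%E; first by rewrite huy leey.
have hu : h u \is a fin_num by rewrite fin_numE hNy huy.
have huE := fineK hu; move: (fine (h u)) huE => fu huE.
have rho0 : 0 < rho by lra.
have t01 : 0 <= rho^-1 <= 1 by rewrite invr_ge0 ltW//= invf_le1.
have := hconv u u0 _ t01; rewrite -huE -hu0E -!EFinM -EFinD.
set w := _ + _ => hw.
have Kw : (h m <= h w)%E.
  apply: mmin; apply: in_box.
  have -> : w - u0 = rho^-1 *: (u - u0).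
    by apply/rowP => i; rewrite !mxE; ring.
  by rewrite enormZ gtr0_norm ?invr_gt0// mulVf// gt_eqF.
have := le_trans Kw hw; rewrite -hmE !lee_fin => /(ler_wpM2l (ltW rho0)).
clear hw Kw mu0 mmin hu0E hmE huE.
have -> : rho * (rho^-1 * fu + (1 - rho^-1) * fu0) = fu + (rho - 1) * fu0.
  by field; lra.
by lra.
Qed.

(** The quadratic term dominates the linear lower bound on h, so a minimizer on
    a large enough box is a global one. *)
Lemma argmin_prox_nonempty h v (k : R) : 0 < k -> proper_lsc_convex h ->
  exists u, argmin (fun u => h u + (k * sqnorm (u - v)%R)%:E)%E u.
Proof.
move=> k_gt0 hh; have [u0 [K [hu0 Kle]]] := proper_lsc_convex_lower_bound hh.
have [[hNy _] lsc hconv] := hh.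
have hu0E := fineK hu0; move: (fine (h u0)) hu0E Kle => fu0 hu0E Kle.
pose phi u := (h u + (k * sqnorm (u - v)%R)%:E)%E; rewrite -/phi.
have lscphi : lower_semicontinuous phi.
  move=> u a; rewrite /phi addeC -lteBlDl// -EFinB.
  move=> /ereal_between[c /andP[ac cu]].
  have [V Vu hV] := lsc _ _ cu.
  rewrite lte_fin in ac.
  have ck : {for u, continuous (fun u => k * sqnorm (u - v))}.
    exact: (cvgMl_tmp (@sqnorm_continuous v u)).
  exists (V `&` [set w | a - c < k * sqnorm (w - v)]).
    apply: filterI => //; apply: (cvgr_gt _ ck); lra.
  move=> w [/hV cw /= aw].
  rewrite addeC -lteBlDl// -EFinB; apply: lt_trans cw; rewrite lte_fin; lra.
set a := enorm (u0 - v).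
have a_ge0 : 0 <= a by exact: enorm_ge0.
pose rho0 := 1 + 2 * a + `|K| / k.
have rho01 : 1 <= rho0.
  by have := divr_ge0 (normr_ge0 K) (ltW k_gt0); rewrite /rho0; lra.
have K0 : [set w | forall i, w ord0 i \in `[u0 ord0 i - rho0, u0 ord0 i + rho0]] u0.
  by apply: in_box; rewrite subrr /enorm sqnorm0 sqrtr0; lra.
have [|u Ku umin] := lower_semicontinuous_min (@box_compact u0 rho0) _ lscphi.
  by exists u0.
exists u => w.
have [wle|wgt] := leP (enorm (w - u0)) rho0.
  by apply: umin; exact: in_box.
apply: le_trans (umin _ K0) _; rewrite /phi.
set rho := enorm (w - u0) in wgt.
have rho_gt0 : 0 < rho by lra.
apply: (@le_trans _ _ ((fu0 - K * rho)%:E + (k * sqnorm (w - v))%:E)%E);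
  last by apply: leeD2r; apply: Kle; rewrite -/rho; lra.
rewrite -hu0E -!EFinD lee_fin.
have -> : w - v = (w - u0) + (u0 - v).
  by apply/rowP => i; rewrite !mxE; ring.
have h1 : sqnorm (u0 - v) + rho ^+ 2 - 2 * (rho * a) <=
    sqnorm (w - u0 + (u0 - v)).
  have := cauchy_schwarz (- (w - u0)) (u0 - v).
  rewrite enormN -/rho -/a sqr_enorm !sqnormE; move: (w - u0) (u0 - v) => x y.
  by rewrite !dotE (dotC y x); lra.
have h2 := ler_wpM2l (ltW k_gt0) h1.
have h3 : K * rho <= k * rho * (rho - 2 * a).
  have Kk : `|K| / k <= rho - 2 * a by move: wgt; rewrite /rho0; lra.
  have h4 : `|K| <= k * (rho - 2 * a) by rewrite -ler_pdivrMl// mulrC.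
  have h5 := ler_wpM2r (ltW rho_gt0) (le_trans (ler_norm K) h4).
  by lra.
by lra.
Qed.

Lemma prox_subgradient h (c : R) v : 0 < c -> proper_lsc_convex h ->
  subgradient h (prox c h v) (c^-1 *: (v - prox c h v)).
Proof.
move=> c_gt0 hh.
have k_gt0 : 0 < (2 * c)^-1 by rewrite invr_gt0 mulr_gt0.
have [u uP] := argmin_prox_nonempty v k_gt0 hh.
have : argmin (fun u => h u + ((2 * c)^-1 * sqnorm (u - v)%R)%:E)%E (prox c h v).
  exact: (xgetI _ uP).
move: (prox c h v) => p pmin.
have [[hNy [u0 hu0y]] _ _] := hh.
have hp : h p \is a fin_num.
  rewrite fin_numE hNy /=; apply: contra_neq hu0y => hpy.
  by have := pmin u0; rewrite hpy addye// leye_eq => /eqP; case: (h u0) (hNy u0).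
rewrite -[_ *: _]opprK; apply: subgradient_of_quadratic_bound => // w hw.
exists ((2 * c)^-1 * sqnorm (w - p)) => t t01.
have := pmin (p + t *: (w - p)).
set hpt := h (p + _).
have -> : p + t *: (w - p) - v = (p - v) + t *: (w - p).
  by apply/rowP => i; rewrite !mxE; ring.
move: (w - p) => e.
rewrite -(fineK hp); case: hpt => [r| |]//; last by move=> _; rewrite addye// leey.
rewrite -!EFinD !lee_fin => le1.
have -> : dot (- (c^-1 *: (v - p))) e = (2 * c)^-1 * (2 * dot (p - v) e).
  by rewrite -scalerN opprB dotZl; field; lra.
move: le1; rewrite !sqnormE; move: (p - v) => f; rewrite !dotE (dotC e f).
move: ((2 * c)^-1) => k; lra.
Qed.

End Subgradient.

(** * First-order inequalities for strongly convex-concave functions *)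

Section Gradient.
Variables (R : realType) (d : nat).
Implicit Types (f : 'rV[R]_d -> R) (x y v : 'rV[R]_d).

Lemma derive_grad f x v : differentiable f x -> 'D_v f x = dot (grad f x) v.
Proof.
move=> df; rewrite deriveE// [in LHS](row_sum_delta v) linear_sum.
apply: eq_bigr => i _; rewrite linearZ mxE deriveE//=.
by rewrite /GRing.scale/= mulrC.
Qed.

Lemma derive_sqnorm x v : is_derive x v (@sqnorm R d) (2 * dot x v).
Proof.
have H : h^-1 *: ((@sqnorm R d \o shift x) (h *: v) - sqnorm x) @[h --> (0:R)^']
    --> 2 * dot x v.
  apply: (@cvg_trans _ (2 * dot x v + h * sqnorm v @[h --> (0:R)^'])).
    apply: near_eq_cvg; near=> h.
    have h0 : h != 0 by near: h; exact: nbhs_dnbhs_neq.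
    rewrite /= /shift !sqnormE !dotE (dotC v x) /GRing.scale/=.
    by field.
  apply: (@cvg_within_filter _ _ _ (nbhs (0:R))).
  suff : 2 * dot x v + h * sqnorm v @[h --> (0:R)] --> 2 * dot x v + 0 * sqnorm v.
    by rewrite mul0r addr0.
  apply: cvgD; first exact: cvg_cst.
  by apply: cvgMr_tmp; exact: cvg_id.
apply: DeriveDef; first by apply/cvg_ex; exists (2 * dot x v).
exact: cvg_lim H.
Unshelve. all: by end_near. Qed.

Lemma grad_add_sqnorm f (k c : R) x : differentiable f x ->
  grad (fun x => f x + k * sqnorm x + c) x = grad f x + (2 * k) *: x.
Proof.
move=> df; apply/rowP => i; rewrite !mxE.
have dif := derivableP (@diff_derivable _ _ _ _ _ (delta_mx ord0 i) df).
have dis := is_deriveZ k (derive_sqnorm x (delta_mx ord0 i)).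
have dic := is_derive_cst c x (delta_mx ord0 i).
rewrite (_ : (fun x => _) = f + k \*: @sqnorm R d + cst c); last exact/funext.
have [_ ->] := is_deriveD (is_deriveD dif dis) dic.
rewrite addr0; congr (_ + _).
rewrite /dot (bigD1 i)//= big1 ?addr0 => [|j ji].
  by rewrite mxE !eqxx mulr1 /GRing.scale/=; ring.
by rewrite mxE (negbTE ji) andbF mulr0.
Qed.

Lemma gradN f x : differentiable f x -> grad (fun x => - f x) x = - grad f x.
Proof.
move=> df; apply/rowP => i; rewrite !mxE.
exact: (deriveN (@diff_derivable _ _ _ _ _ _ df)).
Qed.

(** The difference quotient of f along y - x is at most
    f y - f x - mu / 2 * (1 - h) * |y - x|^2; let h tend to 0 from the right. *)
Lemma strongly_convex_grad_le (mu : R) f x y : differentiable f x ->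
  strongly_convex mu f ->
  f x + dot (grad f x) (y - x) + mu / 2 * sqnorm (y - x) <= f y.
Proof.
move=> df fconv; rewrite -derive_grad//; set v := y - x.
have dq := cvg_dnbhs_at_right (@diff_derivable _ _ _ _ _ v df).
set q := (fun h : R => _) in dq.
have H : q h - mu / 2 * sqnorm v * h @[h --> (0:R)^'+] -->
    'D_v f x - mu / 2 * sqnorm v * 0.
  apply: cvgB; first exact: dq.
  apply: cvgMl_tmp; apply: cvg_at_right_filter; exact: cvg_id.
rewrite mulr0 subr0 in H.
suff : 'D_v f x <= f y - f x - mu / 2 * sqnorm v by lra.
rewrite -(cvg_lim _ H)//; apply: limr_le; first by apply/cvg_ex; eexists; exact: H.
near=> h.
have h0 : 0 < h by near: h; exact: nbhs_right_gt.
have h1 : h <= 1 by near: h; exact: nbhs_right_le.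
have := fconv y x h; rewrite (ltW h0) h1 => /(_ isT).
have -> : h *: y + (1 - h) *: x = h *: v + x.
  by apply/rowP => i; rewrite !mxE; ring.
rewrite -/v /q /= /shift /= /GRing.scale /= => h2.
have e : h * (h^-1 * (f (h *: v + x) - f x)) = f (h *: v + x) - f x.
  by rewrite mulrA mulfV ?mul1r// gt_eqF.
by rewrite -(ler_pM2l h0) mulrBr e; lra.
Unshelve. all: by end_near. Qed.

End Gradient.

Section SaddleFunction.
Variables (R : realType) (dx dy : nat).
Variables (F : 'rV[R]_dx -> 'rV[R]_dy -> R) (mux muy L : R).
Implicit Types (x : 'rV[R]_dx) (y : 'rV[R]_dy).

Hypothesis mux_gt0 : 0 < mux.
Hypothesis muy_gt0 : 0 < muy.
Hypothesis L_gt0 : 0 < L.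
Hypothesis F_diff : continuously_differentiable F.
Hypothesis F_cvx : forall y, strongly_convex mux (fun x => F x y).
Hypothesis F_ccv : forall x, strongly_convex muy (fun y => - F x y).
Hypothesis F_smooth : smooth L F.

Lemma differentiable_x x y : differentiable (F ^~ y) x.
Proof.
have [Fd _ _] := F_diff.
rewrite (_ : F ^~ y = (fun p => F p.1 p.2) \o (fun x => (x, y)))//.
apply: differentiable_comp; last exact: Fd.
exact: differentiable_pair.
Qed.

Lemma differentiable_y x y : differentiable (F x) y.
Proof.
have [Fd _ _] := F_diff.
rewrite (_ : F x = (fun p => F p.1 p.2) \o (fun y => (x, y)))//.
apply: differentiable_comp; last exact: Fd.
exact: differentiable_pair.
Qed.

Lemma gradx_le x1 x2 y :
  F x1 y + dot (gradx F x1 y) (x2 - x1) + mux / 2 * sqnorm (x2 - x1) <= F x2 y.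
Proof. exact: (strongly_convex_grad_le _ (differentiable_x _ _) (F_cvx y)). Qed.

Lemma grady_ge x y1 y2 :
  F x y2 <= F x y1 + dot (grady F x y1) (y2 - y1) - muy / 2 * sqnorm (y2 - y1).
Proof.
have dN : differentiable (fun y => - F x y) y1.
  exact: differentiableN (differentiable_y _ _).
have := strongly_convex_grad_le y2 dN (F_ccv x).
by rewrite (gradN (differentiable_y _ _)) dotNl -/(grady F x y1); lra.
Qed.

Lemma gradx_Fhat x y : gradx (Fhat F mux muy) x y = gradx F x y - mux *: x.
Proof.
rewrite /gradx (_ : Fhat F mux muy ^~ y =
  fun x => F x y + - (mux / 2) * sqnorm x + muy / 2 * sqnorm y); last first.
  by apply/funext => x'; rewrite /Fhat mulNr.
rewrite grad_add_sqnorm; last exact: differentiable_x.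
by rewrite (_ : 2 * - (mux / 2) = - mux) ?scaleNr//; field.
Qed.

Lemma grady_Fhat x y : grady (Fhat F mux muy) x y = grady F x y + muy *: y.
Proof.
rewrite /grady (_ : Fhat F mux muy x =
  fun y => F x y + muy / 2 * sqnorm y + (- (mux / 2 * sqnorm x))); last first.
  by apply/funext => y'; rewrite /Fhat addrAC.
rewrite grad_add_sqnorm; last exact: differentiable_y.
by rewrite (_ : 2 * (muy / 2) = muy)//; field.
Qed.

Lemma gradx_Fhat_le x1 x2 y : Fhat F mux muy x1 y
    + dot (gradx (Fhat F mux muy) x1 y) (x2 - x1) <= Fhat F mux muy x2 y.
Proof.
have := gradx_le x1 x2 y; rewrite gradx_Fhat /Fhat !sqnormE !dotE (dotC x2 x1).
by lra.
Qed.

Lemma grady_Fhat_ge x y1 y2 : Fhat F mux muy x y2 <=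
  Fhat F mux muy x y1 + dot (grady (Fhat F mux muy) x y1) (y2 - y1).
Proof.
have := grady_ge x y1 y2; rewrite grady_Fhat /Fhat !sqnormE !dotE (dotC y2 y1).
by lra.
Qed.

Lemma saddle_monotone x1 y1 x2 y2 :
  mux * sqnorm (x1 - x2) + muy * sqnorm (y1 - y2) <=
  dot (gradx F x1 y1 - gradx F x2 y2) (x1 - x2)
  - dot (grady F x1 y1 - grady F x2 y2) (y1 - y2).
Proof.
have := gradx_le x1 x2 y1; have := gradx_le x2 x1 y2.
have := grady_ge x1 y1 y2; have := grady_ge x2 y2 y1.
rewrite !(sqnormBC x2) !(sqnormBC y2).
by rewrite !(dotDl _ _ (_ - _)) !dotNl !dotE; lra.
Qed.

Lemma gradx_lip x1 y1 x2 y2 :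
  enorm (gradx F x1 y1 - gradx F x2 y2) <= L * (enorm (x1 - x2) + enorm (y1 - y2)).
Proof.
have hx := enorm_ge0 (x1 - x2); have hy := enorm_ge0 (y1 - y2).
rewrite ler_enorm; last by rewrite mulr_ge0 ?addr_ge0// ltW.
have := F_smooth x1 x2 y1 y2; have := sqnorm_ge0 (grady F x1 y1 - grady F x2 y2).
rewrite -!(sqr_enorm (_ - _)) !exprMn => h1 h2.
have h3 : L ^+ 2 * (enorm (x1 - x2) ^+ 2 + enorm (y1 - y2) ^+ 2) <=
    L ^+ 2 * (enorm (x1 - x2) + enorm (y1 - y2)) ^+ 2.
  by rewrite ler_wpM2l ?sqr_ge0//; nra.
lra.
Qed.

Lemma grady_lip x y1 y2 :
  enorm (grady F x y1 - grady F x y2) <= L * enorm (y1 - y2).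
Proof.
rewrite ler_enorm; last by rewrite mulr_ge0 ?enorm_ge0// ltW.
have := F_smooth x x y1 y2; have := sqnorm_ge0 (gradx F x y1 - gradx F x y2).
by rewrite subrr sqnorm0 exprMn sqr_enorm; lra.
Qed.

Lemma mux_le_L : (0 < dx)%N -> mux <= L.
Proof.
move=> dx0; pose x : 'rV[R]_dx := delta_mx ord0 (Ordinal dx0).
have x1 : sqnorm x = 1.
  rewrite /sqnorm (bigD1 (Ordinal dx0))//= big1 => [|j /negbTE ji].
    by rewrite mxE !eqxx expr1n addr0.
  by rewrite mxE ji andbF expr0n.
have ex1 : enorm x = 1 by rewrite /enorm x1 sqrtr1.
have := saddle_monotone x 0 0 0; have := gradx_lip x 0 0 0.
rewrite subrr subr0 sqnorm0 x1 ex1 /enorm sqnorm0 sqrtr0 -/(enorm _).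
have := cauchy_schwarz (gradx F x 0 - gradx F 0 0) x; rewrite ex1.
by rewrite (dotC _ 0) dot0l; lra.
Qed.

End SaddleFunction.

(** * Optimality conditions at a minimax solution *)

Section Optimality.
Variables (R : realType) (dx dy : nat).
Variables (F : 'rV[R]_dx -> 'rV[R]_dy -> R) (mux muy L : R).
Variables (r : 'rV[R]_dx -> \bar R) (g : 'rV[R]_dy -> \bar R).
Variables (xs : 'rV[R]_dx) (ys : 'rV[R]_dy).

Hypothesis mux_gt0 : 0 < mux.
Hypothesis muy_gt0 : 0 < muy.
Hypothesis L_gt0 : 0 < L.
Hypothesis F_diff : continuously_differentiable F.
Hypothesis F_cvx : forall y, strongly_convex mux (fun x => F x y).
Hypothesis F_ccv : forall x, strongly_convex muy (fun y => - F x y).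
Hypothesis F_smooth : smooth L F.
Hypothesis r_plc : proper_lsc_convex r.
Hypothesis g_plc : proper_lsc_convex g.
Hypothesis sol : minimax_solution F r g xs ys.

Lemma minimax_finite : r xs \is a fin_num /\ g ys \is a fin_num.
Proof.
have [+ _ _] := sol; have [[rNy _] _ _] := r_plc; have [[gNy _] _ _] := g_plc.
rewrite /objective; move: (rNy xs) (gNy ys).
by case: (r xs) => [?| |]//; case: (g ys) => [?| |].
Qed.

Lemma minimax_max y : g y \is a fin_num ->
  F xs y - fine (g y) <= F xs ys - fine (g ys).
Proof.
have [rf gf] := minimax_finite; have [_ _ /(_ y)] := sol => + gy.
rewrite /objective -(fineK rf) -(fineK gf) -(fineK gy) -!EFinD lee_fin/=.
by rewrite -!addrA lerD2l.
Qed.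

Lemma minimax_subgradient_y : subgradient g ys (grady F xs ys).
Proof.
have [rf gf] := minimax_finite; have [[gNy _] _ _] := g_plc.
rewrite -[grady _ _ _]opprK; apply: subgradient_of_quadratic_bound => // w gw.
set e := w - ys; exists (L * sqnorm e) => t /andP[t0 t1].
set yt := ys + t *: e.
have [gty|gty] := eqVneq (g yt) +oo%E; first by rewrite gty addye// leey.
have gt : g yt \is a fin_num by rewrite fin_numE gNy gty.
have h1 := minimax_max gt.
have h2 := grady_ge F_diff F_ccv xs yt ys.
have h3 : 0 <= muy / 2 * sqnorm (ys - yt).
  by rewrite mulr_ge0 ?sqnorm_ge0 ?divr_ge0// ltW.
have ye : ys - yt = - t *: e by apply/rowP => i; rewrite !mxE; ring.
have h4 : dot (grady F xs ys - grady F xs yt) e <= L * (t * sqnorm e).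
  apply: le_trans (cauchy_schwarz _ _) _.
  have := grady_lip L_gt0 F_smooth xs ys yt.
  rewrite ye enormZ normrN gtr0_norm// -(sqr_enorm e).
  by move=> /(ler_wpM2r (enorm_ge0 e)); lra.
rewrite -(fineK gf) -(fineK gt) -EFinD lee_fin /=.
have h5 := ler_wpM2l (ltW t0) h4.
move: h2 h5; rewrite !ye dotZr !dotDl !dotNl expr2.
by move: h1 h3; rewrite ye; lra.
Qed.

Lemma linear_of_quadratic_le (a b t u : R) : 0 <= a -> 0 <= b -> 0 < t ->
  u ^+ 2 <= a * t ^+ 2 + b * (t * u) -> u <= (a + b + 1) * t.
Proof.
move=> a0 b0 t0 h; rewrite leNgt; apply/negP => ut.
have tu : t <= u by nra.
have h1 : t * t <= t * u by rewrite ler_pM2l.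
have h2 : (a + b + 1) * t * u < u * u by rewrite ltr_pM2r//; lra.
have h3 : a * (t * t) <= a * (t * u) by rewrite ler_wpM2l.
have h4 : 0 < t * u by rewrite mulr_gt0//; lra.
nra.
Qed.

(** xs minimizes a supremum over y, whose derivative at xs is that of the
    function at the maximizer ys. Take xt on a segment issued from xs, at
    parameter t. The supremum at xt is at least the value at (xt, ys) and, xs
    being a minimizer, the value at (xs, ys); let yt miss the larger of the two
    by less than t ^+ 2. The first bound and strong concavity in y give
    |yt - ys| = O(t). The second one compares r xs with r xt through the gradient
    at (xt, yt), and replacing it by the gradient at (xs, ys) costs O(t ^+ 2),
    which [subgradient_of_quadratic_bound] accepts. Choosing yt in this way
    avoids asking whether the supremum at xt is finite or attained. *)
Lemma minimax_subgradient_x : subgradient r xs (- gradx F xs ys).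
Proof.
have [rf gf] := minimax_finite; have [[gNy _] _ _] := g_plc.
have [[rNy _] _ _] := r_plc; have [_ xmin _] := sol.
apply: subgradient_of_quadratic_bound => // w rw.
set e := w - xs; set E := enorm e.
have E0 : 0 <= E by exact: enorm_ge0.
pose a := 2 * (1 + L * E ^+ 2) / muy.
pose b := 2 * L * E / muy.
exists (1 + L * E * (E + (a + b + 1))) => t /andP[t0 t1].
set xt := xs + t *: e.
have [rty|rty] := eqVneq (r xt) +oo%E; first by rewrite rty addye// leey.
have rt : r xt \is a fin_num by rewrite fin_numE rNy rty.
have gE := fineK gf; have rE := fineK rf; have rtE := fineK rt.
move: (fine (r xt)) (fine (r xs)) (fine (g ys)) rtE rE gE => vt vr vg rtE rE gE.
pose m := Num.max (vr + F xs ys - vg) (vt + F xt ys - vg).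
have [_ [yt _ <-] myt] : exists2 v,
    range (objective F r g xt) v & ((m - t ^+ 2)%:E < v)%E.
  apply: ereal_sup_gt; apply: (@lt_le_trans _ _ m%:E).
    by rewrite lte_fin ltrBlDr ltrDl exprn_gt0.
  rewrite /m EFin_max ge_max; apply/andP; split.
    apply: le_trans (xmin xt); apply: ereal_sup_ubound; exists ys => //.
    by rewrite /objective -rE -gE.
  by apply: ereal_sup_ubound; exists ys => //; rewrite /objective -rtE -gE.
have gyt : g yt \is a fin_num.
  rewrite fin_numE gNy /=; apply/negP => /eqP gy.
  by move: myt; rewrite /objective gy -rtE.
have hsub := subgradient_le minimax_subgradient_y gyt.
have gtE := fineK gyt; move: (fine (g yt)) gtE hsub => wg gtE hsub.
have hgE : fine (g ys) = vg by rewrite -gE.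
rewrite hgE in hsub.
move: myt; rewrite /objective -rtE -gtE -!EFinD /m lte_fin ltrBlDr gt_max.
move=> /andP[h1 h2].
have h3 := grady_ge F_diff F_ccv xs ys yt.
have h4 := gradx_le F_diff F_cvx xt xs yt.
have h5 := gradx_le F_diff F_cvx xs xt ys.
have xe : xt - xs = t *: e by apply/rowP => i; rewrite !mxE; ring.
have xe' : xs - xt = - t *: e by apply/rowP => i; rewrite !mxE; ring.
have h6 : 0 <= mux / 2 * sqnorm (xs - xt).
  by rewrite mulr_ge0 ?sqnorm_ge0 ?divr_ge0// ltW.
have h7 : 0 <= mux / 2 * sqnorm (xt - xs).
  by rewrite mulr_ge0 ?sqnorm_ge0 ?divr_ge0// ltW.
set D := enorm (yt - ys).
have h8 : dot (gradx F xt yt - gradx F xs ys) e <= L * (t * E + D) * E.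
  apply: le_trans (cauchy_schwarz _ _) _; apply: ler_wpM2r => //.
  have := gradx_lip L_gt0 F_smooth xt yt xs ys.
  by rewrite xe enormZ gtr0_norm.
rewrite -(sqr_enorm (yt - ys)) -/D in h3.
rewrite -/D in h8.
have h9 := ler_wpM2l (ltW t0) h8.
rewrite dotDl dotNl in h9.
rewrite xe dotZr in h5; rewrite xe' dotZr -xe' in h4; rewrite xe in h7.
have hD : D <= (a + b + 1) * t.
  apply: linear_of_quadratic_le => //.
  - rewrite /a divr_ge0 ?(ltW muy_gt0)// mulr_ge0// addr_ge0// mulr_ge0 ?sqr_ge0//.
    exact: ltW.
  - by rewrite /b divr_ge0 ?(ltW muy_gt0)// !mulr_ge0// ltW.
  have m0 : 0 < muy / 2 by rewrite divr_gt0.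
  rewrite -(ler_pM2l m0).
  have -> : muy / 2 * (a * t ^+ 2 + b * (t * D)) =
      (1 + L * E ^+ 2) * t ^+ 2 + L * E * (t * D).
    by rewrite /a /b; field; exact: lt0r_neq0.
  by clear gtE gE rE rtE; lra.
rewrite -rE lee_fin.
have h10 : t * L * E * D <= t * L * E * ((a + b + 1) * t).
  by rewrite ler_wpM2l// !mulr_ge0// ltW.
have h11 : 0 <= muy / 2 * D ^+ 2.
  by rewrite mulr_ge0 ?sqr_ge0// divr_ge0// ltW.
by clear gtE gE rE rtE; lra.
Qed.

End Optimality.

(** * Termination of the inner loop *)

Section InnerLoop.
Variables (R : realType) (dx dy : nat).
Variables (F : 'rV[R]_dx -> 'rV[R]_dy -> R) (mux muy L : R).
Variables (r : 'rV[R]_dx -> \bar R) (g : 'rV[R]_dy -> \bar R).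
Variables (zg : 'rV[R]_dx) (yg : 'rV[R]_dy).

Hypothesis dx_gt0 : (0 < dx)%N.
Hypothesis mux_gt0 : 0 < mux.
Hypothesis muy_gt0 : 0 < muy.
Hypothesis L_gt0 : 0 < L.
Hypothesis F_diff : continuously_differentiable F.
Hypothesis F_cvx : forall y, strongly_convex mux (fun x => F x y).
Hypothesis F_ccv : forall x, strongly_convex muy (fun y => - F x y).
Hypothesis F_smooth : smooth L F.
Hypothesis r_plc : proper_lsc_convex r.
Hypothesis g_plc : proper_lsc_convex g.

Local Notation Pm := (tuned_params mux muy L).
Local Notation lam := (lambda Pm).
Local Notation step := (8 * mux^-1 * lam).
Local Notation it := (inner F r g mux muy Pm zg yg).
Local Notation opx := (ax F mux muy zg).
Local Notation opy := (ay F mux muy Pm yg).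

Lemma sqrt5_bounds : 223 / 100 <= Num.sqrt 5 :> R /\ Num.sqrt 5 <= 225 / 100 :> R.
Proof.
have s0 : 0 <= Num.sqrt 5 :> R by exact: sqrtr_ge0.
have s5 : Num.sqrt 5 ^+ 2 = 5 :> R by rewrite sqr_sqrtr.
by split; nra.
Qed.

Lemma condition_ge1 : 1 <= L / mux.
Proof.
have h := mux_le_L L_gt0 F_diff F_cvx F_ccv F_smooth dx_gt0.
by rewrite ler_pdivlMr// mul1r.
Qed.

Lemma lambdaV : lam^-1 = 2 * Num.sqrt 5 * (1 + 8 * (L / mux)).
Proof. by rewrite /= invrK mulrA. Qed.

Lemma lambda_gt0 : 0 < lam.
Proof.
rewrite -invr_gt0 lambdaV; have := condition_ge1; have [h _] := sqrt5_bounds.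
by move=> h1; rewrite !mulr_gt0//; lra.
Qed.

Lemma lambdaV_ge : 446 / 100 * (1 + 8 * (L / mux)) <= lam^-1.
Proof.
rewrite lambdaV ler_wpM2r//; first by have := condition_ge1; lra.
by have [h _] := sqrt5_bounds; lra.
Qed.

Lemma lambdaV_le : lam^-1 <= 81 / 2 * (L / mux).
Proof.
have h1 := condition_ge1; have [_ h2] := sqrt5_bounds.
rewrite lambdaV; apply: (@le_trans _ _ (9 / 2 * (1 + 8 * (L / mux)))); last lra.
by rewrite ler_wpM2r//; lra.
Qed.

Lemma lambda_le : lam <= 1 / 40.
Proof.
have l0 := lambda_gt0.
have : lam * 40 <= lam * lam^-1.
  by rewrite ler_pM2l//; have := lambdaV_ge; have := condition_ge1; lra.
by rewrite mulfV ?gt_eqF//; lra.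
Qed.

Lemma step_gt0 : 0 < step.
Proof. by rewrite mulr_gt0 ?lambda_gt0// divr_gt0. Qed.

(** With k = L / mux >= 1, the left-hand side is lambda * (8 * k + 4), and
    8 * k + 4 <= 4 / 3 * (1 + 8 * k). *)
Lemma step_lipschitz_le : step * (L + mux / 2) <= 3 / 10.
Proof.
have h1 := condition_ge1; have h2 := lambdaV_ge.
have -> : step * (L + mux / 2) = lam * (8 * (L / mux) + 4).
  by field; exact: lt0r_neq0.
rewrite -ler_pdivlMl ?lambda_gt0//; lra.
Qed.

Lemma axB x1 y1 x2 y2 : opx x1 y1 - opx x2 y2 =
  (gradx F x1 y1 - gradx F x2 y2) - (mux / 2) *: (x1 - x2).
Proof.
rewrite /ax !(gradx_Fhat _ _ F_diff); apply/rowP => i; rewrite !mxE.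
by field; exact: lt0r_neq0.
Qed.

Lemma ayB x1 y1 x2 y2 : opy x1 y1 - opy x2 y2 =
  - (grady F x1 y1 - grady F x2 y2) + (mux / 8) *: (y1 - y2).
Proof.
rewrite /ay !(grady_Fhat _ _ F_diff); apply/rowP => i; rewrite !mxE /=.
by field; exact: lt0r_neq0.
Qed.

Let A (p : 'rV[R]_(dx + dy)) : 'rV[R]_(dx + dy) :=
  row_mx (opx (lsubmx p) (rsubmx p)) (opy (lsubmx p) (rsubmx p)).

Let AE x y : A (row_mx x y) = row_mx (opx x y) (opy x y).
Proof. by rewrite /A row_mxKl row_mxKr. Qed.

Lemma row_mxB (x1 x2 : 'rV[R]_dx) (y1 y2 : 'rV[R]_dy) :
  row_mx x1 y1 - row_mx x2 y2 = row_mx (x1 - x2) (y1 - y2).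
Proof. by rewrite opp_row_mx add_row_mx. Qed.

Lemma inner_op_lip u v : enorm (A u - A v) <= (L + mux / 2) * enorm (u - v).
Proof.
rewrite -(hsubmxK u) -(hsubmxK v) !AE !row_mxB.
move: (lsubmx u) (rsubmx u) (lsubmx v) (rsubmx v) => x1 y1 x2 y2.
rewrite axB ayB -(add_row_mx _ (- (grady _ _ _ - _))).
have h0 : 0 <= enorm (row_mx (x1 - x2) (y1 - y2)) by exact: enorm_ge0.
apply: le_trans (enormD _ _) _; rewrite mulrDl lerD//.
  rewrite ler_enorm ?(mulr_ge0 (ltW L_gt0) h0)// exprMn sqr_enorm.
  by rewrite !sqnorm_row_mx sqnormN; exact: F_smooth.
have m2 : 0 <= mux / 2 by rewrite divr_ge0// ltW.
rewrite ler_enorm ?(mulr_ge0 m2 h0)// exprMn sqr_enorm !sqnorm_row_mx.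
rewrite sqnormN !sqnormZ mulrDr lerD2l ler_wpM2r ?sqnorm_ge0//.
by nra.
Qed.

(** ax loses mux / 2 from the strong convexity modulus mux of F in x, while ay
    only gains from its regularization. *)
Lemma inner_op_monotone u v : 0 <= dot (A u - A v) (u - v).
Proof.
rewrite -(hsubmxK u) -(hsubmxK v) !AE !row_mxB axB ayB dot_row_mx.
move: (lsubmx u) (rsubmx u) (lsubmx v) (rsubmx v) => x1 y1 x2 y2.
have := saddle_monotone F_diff F_cvx F_ccv x1 y1 x2 y2.
have hx := mulr_ge0 (ltW mux_gt0) (sqnorm_ge0 (x1 - x2)).
have hx' := mulr_ge0 (ltW mux_gt0) (sqnorm_ge0 (y1 - y2)).
have hy := mulr_ge0 (ltW muy_gt0) (sqnorm_ge0 (y1 - y2)).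
move: hx hx' hy; rewrite !sqnormE.
move: (x1 - x2) (y1 - y2) (_ - _) (grady _ _ _ - _) => a b c e.
by rewrite !dotE; lra.
Qed.

Lemma inner_subgradient t : subgradient r (in_x (it t)) (in_bx (it t)) /\
  subgradient g (in_y (it t)) (in_by (it t)).
Proof.
by case: t => [|t]; split; apply: prox_subgradient => //; exact: step_gt0.
Qed.

(** The abstract anchored iteration is run on the concatenation of x and y.
    As gamma_x = gamma_y, both blocks use the same step and Euclidean norm, and
    the step is lambda times gamma, so that [anchored_residual_le] with
    l = lambda is the stopping test. *)
Lemma stop_satisfied t : 8 <= lam * t%:R -> stop F mux muy Pm zg yg (it t).
Proof.
move=> lt.
pose p t := row_mx (in_x (it t)) (in_y (it t)).
pose b t := row_mx (in_bx (it t)) (in_by (it t)).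
pose pm := row_mx (xm1 mux zg) (ym1 yg).
pose px t := in_x (it t) + (2 / (t%:R + 3)) *: (in_x (it 0%N) - in_x (it t)).
pose py t := in_y (it t) + (2 / (t%:R + 3)) *: (in_y (it 0%N) - in_y (it t)).
pose q t := row_mx
  (px t - step *: (opx (in_x (it t)) (in_y (it t)) + in_bx (it t)))
  (py t - step *: (opy (in_x (it t)) (in_y (it t)) + in_by (it t))).
have anchorE t' : p t' + (2 / (t'%:R + 3)) *: (p 0%N - p t') =
    row_mx (px t') (py t').
  by rewrite /p row_mxB scale_row_mx add_row_mx.
have qE t' : q t' =
    p t' + (2 / (t'%:R + 3)) *: (p 0%N - p t') - step *: (A (p t') + b t').
  by rewrite anchorE /p /b AE add_row_mx scale_row_mx row_mxB.
have b_mono i j : 0 <= dot (b i - b j) (p i - p j).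
  rewrite !row_mxB dot_row_mx addr_ge0//.
    exact: subgradient_monotone (inner_subgradient i).1 (inner_subgradient j).1.
  exact: subgradient_monotone (inner_subgradient i).2 (inner_subgradient j).2.
have stepV n (u v w : 'rV[R]_n) :
    w = u - step *: v - step *: (step^-1 *: (u - step *: v - w)).
  by rewrite scalerA mulfV ?gt_eqF ?step_gt0// scale1r subKr.
have p0E : p 0%N = pm - step *: A pm - step *: b 0%N.
  rewrite /p /b /pm AE !scale_row_mx !row_mxB /=.
  by congr row_mx; exact: stepV.
have pE i : p i.+1 =
    p i + (2 / (i%:R + 3)) *: (p 0%N - p i) - step *: (A (q i) + b i.+1).
  rewrite anchorE /q /p /b AE add_row_mx scale_row_mx row_mxB.
  by congr row_mx; rewrite scalerDr opprD addrA /=; exact: stepV.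
have := anchored_residual_le step_gt0 step_lipschitz_le inner_op_lip
  inner_op_monotone b_mono p0E qE pE lambda_gt0 lambda_le lt.
rewrite /p /b /pm AE add_row_mx row_mxB.
set u := row_mx _ _; set v := row_mx _ _ => uv0.
have uv : 8 * mux^-1 * enorm u <= enorm v.
  by rewrite -(ler_pM2l lambda_gt0) mulrA (mulrC lam).
have g0 : 0 < 8 * mux^-1 by rewrite divr_gt0.
have uv2 : (8 * mux^-1 * enorm u) ^+ 2 <= enorm v ^+ 2.
  rewrite lerXn2r// nnegrE ?enorm_ge0//.
  exact: mulr_ge0 (ltW g0) (enorm_ge0 _).
rewrite exprMn !sqr_enorm !sqnorm_row_mx in uv2.
rewrite /stop /= -!mulrDr -(ler_pM2l g0) [leRHS]mulrA mulfV ?gt_eqF// mul1r.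
by rewrite mulrA -expr2.
Qed.

Lemma inner_loop_terminates : exists t, [/\
  inner_count F r g mux muy Pm zg yg = Some t,
  stop F mux muy Pm zg yg (it t) & t%:R <= 325 * (L / mux)].
Proof.
have l0 := lambda_gt0.
have hT : 8 <= lam * (Num.truncn (8 / lam)).+1%:R.
  by rewrite mulrC -ler_pdivrMr// ltW// truncnS_gt.
rewrite /inner_count; case: pselect => [stops|[]]; last first.
  by eexists; exact: stop_satisfied hT.
case: ex_minnP => t st tmin; exists t; split=> //.
(* 325 = 8 * 81 / 2 + 1: the bound on 8 / lambda, and a rounding up. *)
have := tmin _ (stop_satisfied hT); rewrite -(ler_nat R) => /le_trans; apply.
rewrite -natr1.
have l8 : 0 <= 8 / lam by rewrite divr_ge0// ltW.
have : (Num.truncn (8 / lam))%:R <= 8 / lam by rewrite truncn_le.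
by have := lambdaV_le; have := condition_ge1; lra.
Qed.

End InnerLoop.

(** * Contraction of the outer loop *)

Section OuterBlock.
Variables (R : realType) (d : nat).

(** One block of the extrapolation step, z or y, with modulus m and proximal
    step theta. The identity z - zs = (zf' - zs) + (zg - zf') / al
    + (1 - al) / al * (zf' - zf) redistributes the inner product of G with
    z - zs over three directions: the first two terms in G are controlled by
    strong convexity, and the last bracket measures how far zf' is from an exact
    proximal step at zg. *)
Lemma accelerated_step_le (z zf zf' zs zg z' G : 'rV[R]_d) (al eta m theta : R) :
  0 < al -> 0 < eta -> 0 < m -> eta * m <= 1 / 2 -> eta <= theta / (2 * al) ->
  zg = al *: z + (1 - al) *: zf ->
  z' = z + (eta * m) *: (zf' - z) - eta *: G ->
  eta^-1 * sqnorm (z' - zs) <= (1 - eta * m) * (eta^-1 * sqnorm (z - zs))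
    + m * sqnorm (zs - zf') + 2 * dot G (zs - zf')
    + 2 * ((1 - al) / al) * dot G (zf - zf')
    + al^-1 * (theta * sqnorm G - 2 * dot G (zg - zf')).
Proof.
move=> al_gt0 eta_gt0 m_gt0 etam etath -> ->.
pose u := zf' - z.
have h1 : 0 <= (m / 2) * sqnorm (u + (2 * eta) *: G).
  by rewrite mulr_ge0 ?sqnorm_ge0// divr_ge0// ltW.
have h2 : 0 <= (eta - 2 * eta * (eta * m)) * sqnorm G.
  by rewrite mulr_ge0 ?sqnorm_ge0//; nra.
have h3 : 0 <= m * (1 / 2 - eta * m) * sqnorm u.
  by rewrite !mulr_ge0 ?sqnorm_ge0//; lra.
have h4 : 0 <= (theta / al - 2 * eta) * sqnorm G.
  rewrite mulr_ge0 ?sqnorm_ge0//.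
  by move: etath; rewrite invfM mulrCA mulrC; lra.
rewrite -subr_ge0.
suff -> : (1 - eta * m) * (eta^-1 * sqnorm (z - zs))
    + m * sqnorm (zs - zf') + 2 * dot G (zs - zf')
    + 2 * ((1 - al) / al) * dot G (zf - zf')
    + al^-1 * (theta * sqnorm G - 2 * dot G (al *: z + (1 - al) *: zf - zf'))
    - eta^-1 * sqnorm (z + (eta * m) *: (zf' - z) - eta *: G - zs) =
  (m / 2) * sqnorm (u + (2 * eta) *: G)
  + (eta - 2 * eta * (eta * m)) * sqnorm G
  + m * (1 / 2 - eta * m) * sqnorm u + (theta / al - 2 * eta) * sqnorm G.
  by rewrite !addr_ge0.
rewrite /u !sqnormE !dotE.
rewrite (dotC zs) (dotC zf' z) (dotC zf') (dotC G z) (dotC G zs) (dotC G zf').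
rewrite (dotC G zf).
by field; rewrite !gt_eqF.
Qed.

End OuterBlock.

(** A and B stand for the weighted squared distances of the two blocks before
    the step, X and Y after it, and v, v', vs for the values of the dual objective
    before the step, after it, and at the solution. The last two hypotheses are the
    convexity inequalities from the new point to the solution and to the previous
    point. *)
Lemma contraction_of_step_bounds (R : realType)
    (al kz ky A B X Y N1 N2 d1 d2 d3 d4 bz by' v v' vs : R) :
  0 < al -> al <= 1 -> al / 2 <= kz -> al / 2 <= ky -> 0 <= A -> 0 <= B ->
  vs <= v ->
  X <= (1 - kz) * A + N1 + 2 * d1 + 2 * ((1 - al) / al) * d3 + al^-1 * bz ->
  Y <= (1 - ky) * B + N2 + 2 * d2 + 2 * ((1 - al) / al) * d4 + al^-1 * by' ->
  bz + by' <= 0 ->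
  v' + d1 + d2 + N1 / 2 + N2 / 2 <= vs -> v' + d3 + d4 <= v ->
  X + Y + 2 / al * (v' - vs) <= (1 - al / 2) * (A + B + 2 / al * (v - vs)).
Proof.
move=> al_gt0 al_le1 kz_ge ky_ge A_ge0 B_ge0 vv hX hY hb h1 h2.
have c1 : 1 <= al^-1 by rewrite invf_ge1.
have alc : (1 - al) / al = al^-1 - 1 by rewrite mulrBl mul1r mulfV ?gt_eqF.
rewrite alc in hX hY.
have hA : (1 - kz) * A <= (1 - al / 2) * A by rewrite ler_wpM2r//; lra.
have hB : (1 - ky) * B <= (1 - al / 2) * B by rewrite ler_wpM2r//; lra.
have -> : (1 - al / 2) * (A + B + 2 / al * (v - vs)) =
    (1 - al / 2) * A + (1 - al / 2) * B + (2 * al^-1 - 1) * (v - vs).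
  by field; rewrite gt_eqF.
have hc : (al^-1 - 1) * (v' + d3 + d4) <= (al^-1 - 1) * v.
  by rewrite ler_wpM2l//; lra.
have hb' : al^-1 * (bz + by') <= 0 by rewrite mulr_ge0_le0// invr_ge0 ltW.
lra.
Qed.

Section OuterLoop.
Variables (R : realType) (dx dy : nat).
Variables (F : 'rV[R]_dx -> 'rV[R]_dy -> R) (mux muy L : R).
Variables (r : 'rV[R]_dx -> \bar R) (g : 'rV[R]_dy -> \bar R).
Variables (xs : 'rV[R]_dx) (ys : 'rV[R]_dy).

Hypothesis dx_gt0 : (0 < dx)%N.
Hypothesis mux_gt0 : 0 < mux.
Hypothesis muy_gt0 : 0 < muy.
Hypothesis L_gt0 : 0 < L.
Hypothesis F_diff : continuously_differentiable F.
Hypothesis F_cvx : forall y, strongly_convex mux (fun x => F x y).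
Hypothesis F_ccv : forall x, strongly_convex muy (fun y => - F x y).
Hypothesis F_smooth : smooth L F.
Hypothesis r_plc : proper_lsc_convex r.
Hypothesis g_plc : proper_lsc_convex g.
Hypothesis sol : minimax_solution F r g xs ys.

Local Notation Pm := (tuned_params mux muy L).
Local Notation Fh := (Fhat F mux muy).
Local Notation al := (alpha Pm).
Local Notation ety := (eta_y Pm).
Local Notation theta := (8 * mux^-1).

(** (x, w) is a subgradient of G at (z, y). *)
Definition dual_graph x y z w : Prop :=
  subgradient r x (z - gradx Fh x y) /\ subgradient g y (w + grady Fh x y).

(** P (z, y), provided x attains the supremum G (z, y). *)
Definition dual_value x y z : R :=
  (2 * mux)^-1 * sqnorm z + muy / 2 * sqnorm y
  + (dot x z - fine (r x) - Fh x y + fine (g y)).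

(** Convexity of F^ in x and the subgradient of r at x1 say that x1 attains the
    supremum G (z1, y1), which is therefore bounded below by its value at x2;
    concavity in y and the subgradient of g at y2 compare that with
    G (z2, y2). *)
Lemma dual_value_ge x1 y1 z1 w1 x2 y2 z2 w2 :
  dual_graph x1 y1 z1 w1 -> dual_graph x2 y2 z2 w2 ->
  dual_value x2 y2 z2
    + dot (x2 + mux^-1 *: z2) (z1 - z2) + dot (w2 + muy *: y2) (y1 - y2)
    + (2 * mux)^-1 * sqnorm (z1 - z2) + muy / 2 * sqnorm (y1 - y2)
  <= dual_value x1 y1 z1.
Proof.
move=> [r1 g1] [r2 g2].
have h1 := subgradient_le r1 r2.1; have h2 := subgradient_le g2 g1.1.
have h3 := gradx_Fhat_le muy F_diff F_cvx x1 x2 y1.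
have h4 := grady_Fhat_ge mux F_diff F_ccv x2 y2 y1.
rewrite /dual_value !sqnormE.
move: h1 h2 h3 h4; rewrite !(dotDl _ _ (_ - _)) !(dotNl _ (_ - _)).
rewrite invfM.
set gx := dot (gradx _ _ _) _; set gy := dot (grady _ _ _) _.
rewrite !dotE (dotC z1 x1) (dotC z1 x2) (dotC z2 z1) (dotC y2 y1) (dotC x2 z2).
by lra.
Qed.

Let zs := - (mux *: xs).
Let ws := - (muy *: ys).

Lemma solution_dual_graph : dual_graph xs ys zs ws.
Proof.
rewrite /dual_graph (gradx_Fhat _ _ F_diff) (grady_Fhat _ _ F_diff) /zs /ws.
have -> : - (mux *: xs) - (gradx F xs ys - mux *: xs) = - gradx F xs ys.
  by apply/rowP => i; rewrite !mxE; ring.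
have -> : - (muy *: ys) + (grady F xs ys + muy *: ys) = grady F xs ys.
  by apply/rowP => i; rewrite !mxE; ring.
split.
- exact: (minimax_subgradient_x mux_gt0 muy_gt0 L_gt0 F_diff F_cvx F_ccv
    F_smooth r_plc g_plc sol).
- exact: (minimax_subgradient_y muy_gt0 L_gt0 F_diff F_ccv
    F_smooth r_plc g_plc sol).
Qed.

Let vs := dual_value xs ys zs.

Lemma solution_value_le x y z w : dual_graph x y z w ->
  vs + (2 * mux)^-1 * sqnorm (z - zs) + muy / 2 * sqnorm (y - ys)
    <= dual_value x y z.
Proof.
move=> gr; have := dual_value_ge gr solution_dual_graph.
have -> : xs + mux^-1 *: zs = 0.
  by rewrite /zs scalerN scalerA mulVf ?gt_eqF// scale1r subrr.
by rewrite /ws addNr !dot0l !addr0.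
Qed.

Lemma alpha_gt0 : 0 < al.
Proof. by rewrite /= lt_min ltr01 sqrtr_gt0 !mulr_gt0 ?invr_gt0. Qed.

Lemma alpha_le1 : al <= 1.
Proof. by rewrite /= ge_min lexx. Qed.

Lemma alpha_sqr_le : al ^+ 2 <= theta * muy.
Proof.
have t0 : 0 <= theta * muy by rewrite !mulr_ge0 ?invr_ge0 ?ltW.
rewrite -(sqr_sqrtr t0) lerXn2r ?nnegrE ?sqrtr_ge0 ?(ltW alpha_gt0)//.
by rewrite /= ge_min lexx orbT.
Qed.

Lemma eta_y_gt0 : 0 < ety.
Proof.
have := alpha_gt0; rewrite /= => al0.
by rewrite lt_min invr_gt0 mulr_gt0//= !divr_gt0// mulr_gt0.
Qed.

Lemma eta_y_muy_le : ety * muy <= 1 / 2.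
Proof.
have : ety <= (2 * muy)^-1 by rewrite /= ge_min lexx.
move=> /(ler_wpM2r (ltW muy_gt0)) /le_trans; apply.
by rewrite invfM mulfVK ?gt_eqF// mul1r.
Qed.

Lemma eta_y_le : ety <= theta / (2 * al).
Proof. by rewrite /= ge_min lexx orbT. Qed.

Lemma eta_y_muy_ge : al / 2 <= ety * muy.
Proof.
have a0 := alpha_gt0; have a1 := alpha_le1; have a2 := alpha_sqr_le.
have : al / 2 / muy <= ety.
  rewrite [ety](_ : _ = Num.min (2 * muy)^-1 (theta / (2 * al)))// le_min.
  apply/andP; split.
    rewrite invfM; apply: ler_wpM2r; first by rewrite invr_ge0 ltW.
    lra.
  rewrite ler_pdivrMr// -(ler_pM2r a0).
  have -> : theta / (2 * al) * muy * al = theta * muy / 2.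
    by field; rewrite !gt_eqF.
  by move: a2; rewrite expr2; lra.
by rewrite ler_pdivrMr.
Qed.

Implicit Type s : outer_state R dx dy.

(** v is the value of the dual objective at (zf, yf), witnessed by a subgradient.
    The initial state need not be certified, because g y0 may be infinite. *)
Definition certified s (v : R) : Prop :=
  exists x w, dual_graph x (out_yf s) (out_zf s) w /\
    v = dual_value x (out_yf s) (out_zf s).

Definition outer_potential s v : R :=
  (mux / 2)^-1 * sqnorm (out_z s - zs) + ety^-1 * sqnorm (out_y s - ys)
  + 2 / al * (v - vs).

Lemma certified_value_ge s v : certified s v -> vs <= v.
Proof.
move=> [x [w [gr ->]]]; have := solution_value_le gr.
have := mulr_ge0 (ltW mux_gt0) (sqnorm_ge0 (out_z s - zs)).
have h1 : 0 <= (2 * mux)^-1 * sqnorm (out_zf s - zs).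
  by rewrite mulr_ge0 ?sqnorm_ge0// invr_ge0 mulr_ge0// ltW.
have h2 : 0 <= muy / 2 * sqnorm (out_yf s - ys).
  by rewrite mulr_ge0 ?sqnorm_ge0// divr_ge0// ltW.
lra.
Qed.

Lemma outer_output_le s v : certified s v ->
  sqnorm (- (mux^-1 *: out_z s) - xs) + sqnorm (out_y s - ys)
    <= ((2 * mux)^-1 + ety) * outer_potential s v.
Proof.
move=> /certified_value_ge hv.
have e0 := eta_y_gt0; have a0 := alpha_gt0.
have -> : - (mux^-1 *: out_z s) - xs = - mux^-1 *: (out_z s - zs).
  apply/rowP => i; rewrite /zs !mxE; field; exact: lt0r_neq0.
rewrite sqnormZ sqrrN /outer_potential.
have h1 : 0 <= sqnorm (out_z s - zs) by exact: sqnorm_ge0.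
have h2 : 0 <= sqnorm (out_y s - ys) by exact: sqnorm_ge0.
move: (sqnorm (out_z s - zs)) (sqnorm (out_y s - ys)) h1 h2 => p q p0 q0.
have h3 : 0 <= 2 / al * (v - vs) by rewrite mulr_ge0 ?subr_ge0// divr_ge0// ltW.
have -> : mux^-1 ^+ 2 * p + q =
    (2 * mux)^-1 * ((mux / 2)^-1 * p) + ety * (ety^-1 * q).
  by field; rewrite !gt_eqF.
have p1 : 0 <= (mux / 2)^-1 * p by rewrite mulr_ge0// invr_ge0 divr_ge0// ltW.
have q1 : 0 <= ety^-1 * q by rewrite mulr_ge0// invr_ge0 ltW.
have m1 : 0 <= (2 * mux)^-1 by rewrite invr_ge0 mulr_ge0// ltW.
nra.
Qed.

(** For exact proximal steps, mux Gz = zg - zf and theta Gy = yg - yf. The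
    residuals of the inner loop are the errors in these equations, up to
    a factor; completing squares, the brackets are at most
    the difference of the two sides of the stopping test. *)
Lemma stop_bracket_le zg yg (i : inner_state R dx dy) zf wf Gz Gy :
  stop F mux muy Pm zg yg i ->
  zf = gradx Fh (in_x i) (in_y i) + in_bx i ->
  wf = - grady Fh (in_x i) (in_y i) + in_by i ->
  Gz = in_x i + mux^-1 *: zf -> Gy = wf + muy *: in_y i ->
  (mux * sqnorm Gz - 2 * dot Gz (zg - zf))
  + (theta * sqnorm Gy - 2 * dot Gy (yg - in_y i)) <= 0.
Proof.
move=> + zfE wfE GzD GyD; rewrite /stop /=.
set Dx := ax _ _ _ _ _ _ + _; set Dy := ay _ _ _ _ _ _ _ + _.
set u := in_x i - xm1 mux zg; set v := in_y i - ym1 yg => st.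
have GzE : mux *: Gz = 2 *: Dx + (zg - zf).
  rewrite GzD /Dx /ax zfE; apply/rowP => j; rewrite !mxE.
  by field; exact: lt0r_neq0.
have zE : zg - zf = (mux / 2) *: u - Dx.
  rewrite /u /Dx /ax zfE /xm1; apply/rowP => j; rewrite !mxE.
  by field; exact: lt0r_neq0.
have GyE : Gy = Dy - theta^-1 *: v.
  rewrite GyD wfE /Dy /ay /v /ym1; apply/rowP => j; rewrite !mxE /=.
  by field; exact: lt0r_neq0.
have yE : yg - in_y i = - v by rewrite opprB.
have GzE' : Gz = mux^-1 *: (2 *: Dx + (zg - zf)).
  by rewrite -GzE scalerA mulVf ?gt_eqF// scale1r.
rewrite GzE' zE GyE yE.
have h1 : 0 <= 2 / mux * sqnorm (Dx - (mux / 4) *: u).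
  by rewrite mulr_ge0 ?sqnorm_ge0// divr_ge0// ltW.
have h2 : 0 <= mux^-1 * sqnorm Dx.
  by rewrite mulr_ge0 ?sqnorm_ge0// invr_ge0 ltW.
have thV : theta^-1 = mux / 8 by rewrite invfM invrK mulrC.
rewrite thV in st *.
clear GzE zE GyE yE GzE'; clearbody Dx Dy u v.
rewrite -oppr_ge0.
have -> : - ((mux * sqnorm (mux^-1 *: (2 *: Dx + ((mux / 2) *: u - Dx)))
  - 2 * dot (mux^-1 *: (2 *: Dx + ((mux / 2) *: u - Dx))) ((mux / 2) *: u - Dx))
  + (theta * sqnorm (Dy - (mux / 8) *: v)
    - 2 * dot (Dy - (mux / 8) *: v) (- v))) =
  2 / mux * sqnorm (Dx - (mux / 4) *: u) + 3 * (mux^-1 * sqnorm Dx)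
  + (mux / 8 * sqnorm u + mux / 8 * sqnorm v
     - (theta * sqnorm Dx + theta * sqnorm Dy)).
  rewrite !sqnormE !dotE (dotC u Dx) (dotC v Dy).
  by field; exact: lt0r_neq0.
by apply: addr_ge0; [apply: addr_ge0 => //; apply: mulr_ge0|rewrite subr_ge0].
Qed.

Lemma outer_step_contracts s : exists s', [/\
  outer_step F r g mux muy Pm s = Some s',
  (out_evals s')%:R <= (out_evals s)%:R + 978 * (L / mux) :> R &
  exists v', certified s' v' /\
    forall v, certified s v ->
      outer_potential s' v' <= (1 - al / 2) * outer_potential s v].
Proof.
have [t [tE st tle]] := inner_loop_terminates
  (al *: out_z s + (1 - al) *: out_zf s) (al *: out_y s + (1 - al) *: out_yf s)
  dx_gt0 mux_gt0 muy_gt0 L_gt0 F_diff F_cvx F_ccv F_smooth r_plc g_plc.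
rewrite /outer_step tE.
set zg := al *: out_z s + _ in st *; set yg := al *: out_y s + _ in st *.
have [subx suby] := inner_subgradient zg yg dx_gt0 mux_gt0 L_gt0
  F_diff F_cvx F_ccv F_smooth r_plc g_plc t.
set i := inner _ _ _ _ _ _ _ _ t in st subx suby *.
set zf := _ + in_bx i; set wf := _ + in_by i.
have br := stop_bracket_le st erefl erefl erefl erefl; rewrite -/zf -/wf in br.
eexists; split; first reflexivity.
  (* 3 t + 3 evaluations, and 978 = 3 * 325 + 3. *)
  rewrite /= natrD lerD2l /outer_evals mulSn mul1n -addn1 !natrD.
  have := condition_ge1 dx_gt0 mux_gt0 L_gt0 F_diff F_cvx F_ccv F_smooth.
  by lra.
exists (dual_value (in_x i) (in_y i) zf).
have gr' : dual_graph (in_x i) (in_y i) zf wf.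
  rewrite /dual_graph /zf /wf; split.
    by rewrite addrAC subrr add0r.
  by rewrite addrAC addNr add0r.
split; first by exists (in_x i), wf.
move=> v cv; have hv := certified_value_ge cv; have [x [w [gr vE]]] := cv.
have hz := @accelerated_step_le _ _ (out_z s) (out_zf s) zf zs zg _
  (in_x i + mux^-1 *: zf) al (mux / 2) mux^-1 mux (alpha_gt0).
have hy := @accelerated_step_le _ _ (out_y s) (out_yf s) (in_y i) ys yg _
  (wf + muy *: in_y i) al ety muy theta alpha_gt0 eta_y_gt0 muy_gt0
  eta_y_muy_le eta_y_le erefl erefl.
have m2 : 0 < mux / 2 by rewrite divr_gt0.
have mV : 0 < mux^-1 by rewrite invr_gt0.
have e1 : mux / 2 * mux^-1 <= 1 / 2 by rewrite mulrAC mulfV ?gt_eqF.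
have al0 := alpha_gt0; have al1 := alpha_le1.
have e2 : mux / 2 <= mux / (2 * al).
  rewrite ler_pdivlMr ?mulr_gt0//.
  have -> : mux / 2 * (2 * al) = mux * al by field.
  by rewrite ler_piMr// ltW.
have {}hz := hz _ m2 mV e1 e2 erefl erefl.
have k1 := dual_value_ge solution_dual_graph gr'.
have k2 := dual_value_ge gr gr'; rewrite -vE in k2; rewrite -/vs in k1.
have kap := eta_y_muy_ge.
have A0 : 0 <= (mux / 2)^-1 * sqnorm (out_z s - zs).
  by rewrite mulr_ge0 ?sqnorm_ge0// invr_ge0 ltW.
have B0 : 0 <= ety^-1 * sqnorm (out_y s - ys).
  by rewrite mulr_ge0 ?sqnorm_ge0// invr_ge0 ltW// eta_y_gt0.
have kz : al / 2 <= mux / 2 * mux^-1 by rewrite mulrAC mulfV ?gt_eqF//; lra.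
have n1 : 0 <= (2 * mux)^-1 * sqnorm (out_zf s - zf).
  by rewrite mulr_ge0 ?sqnorm_ge0// invr_ge0 mulr_ge0// ltW.
have n2 : 0 <= muy / 2 * sqnorm (out_yf s - in_y i).
  by rewrite mulr_ge0 ?sqnorm_ge0// divr_ge0// ltW.
apply: (contraction_of_step_bounds al0 al1 kz kap A0 B0 hv hz hy br).
  by move: k1; rewrite invfM; lra.
by lra.
Qed.

End OuterLoop.

(** * Complexity *)

Section Complexity.
Variables (R : realType) (dx dy : nat).
Variables (F : 'rV[R]_dx -> 'rV[R]_dy -> R) (mux muy L : R).
Variables (r : 'rV[R]_dx -> \bar R) (g : 'rV[R]_dy -> \bar R).
Variables (xs : 'rV[R]_dx) (ys : 'rV[R]_dy).

Hypothesis dx_gt0 : (0 < dx)%N.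
Hypothesis mux_gt0 : 0 < mux.
Hypothesis muy_gt0 : 0 < muy.
Hypothesis L_gt0 : 0 < L.
Hypothesis F_diff : continuously_differentiable F.
Hypothesis F_cvx : forall y, strongly_convex mux (fun x => F x y).
Hypothesis F_ccv : forall x, strongly_convex muy (fun y => - F x y).
Hypothesis F_smooth : smooth L F.
Hypothesis r_plc : proper_lsc_convex r.
Hypothesis g_plc : proper_lsc_convex g.
Hypothesis sol : minimax_solution F r g xs ys.
Variables (z0 : 'rV[R]_dx) (y0 : 'rV[R]_dy).

Local Notation Pm := (tuned_params mux muy L).
Local Notation al := (alpha Pm).

(** The constant is the potential after one pass, the first state that is
    certified. *)
Lemma foam_linear_convergence : exists C1 : R, forall n, exists s v, [/\
  foam F r g mux muy Pm z0 y0 n.+1 = Some s,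
  certified F mux muy r g s v,
  outer_potential F mux muy L r g xs ys s v <= (1 - al / 2) ^+ n * C1 &
  (out_evals s)%:R <= n.+1%:R * (978 * (L / mux)) :> R].
Proof.
have next s := outer_step_contracts dx_gt0 mux_gt0 muy_gt0 L_gt0
  F_diff F_cvx F_ccv F_smooth r_plc g_plc sol s.
have [s1 [s1E e1 [v1 [c1 _]]]] := next (OuterState z0 y0 z0 y0 0).
exists (outer_potential F mux muy L r g xs ys s1 v1).
elim=> [|n [s [v [sE cv pv ev]]]].
  by exists s1, v1; split; rewrite // ?expr0 ?mul1r//; rewrite add0r in e1.
have [s' [s'E e' [v' [c' p']]]] := next s.
exists s', v'; split=> //.
- by rewrite /foam iterS -/(foam _ _ _ _ _ _ _ _ _) sE.
- apply: le_trans (p' _ cv) _; rewrite exprS -mulrA ler_wpM2l//.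
  by have := alpha_le1 mux muy L; lra.
- by rewrite -[n.+2%:R]natr1; lra.
Qed.

Lemma exp_decay_le (C eps : R) n : 0 < C -> 0 < eps ->
  2 / al * ln (C / eps) <= n%:R -> C * (1 - al / 2) ^+ n <= eps.
Proof.
move=> C0 eps0 hn.
have al0 : 0 < al := alpha_gt0 L mux_gt0 muy_gt0.
have al1 := alpha_le1 mux muy L.
have Ce : 0 < C / eps by rewrite divr_gt0.
apply: (@le_trans _ _ (C * expR (- ln (C / eps)))).
  rewrite ler_pM2l//.
  apply: (@le_trans _ _ (expR (- (al / 2)) ^+ n)).
    have := expR_ge1Dx (- (al / 2)) => h.
    by rewrite lerXn2r// ?nnegrE ?expR_ge0//; lra.
  rewrite -expRM_natr ler_expR.
  move: hn; rewrite mulrAC ler_pdivrMr//; lra.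
rewrite expRN lnK ?posrE// invf_div mulrCA mulfV ?mulr1//.
by rewrite gt_eqF.
Qed.

Lemma alpha_ge : muy <= mux -> Num.sqrt (mux * muy) <= mux * al.
Proof.
move=> yx.
have -> : mux * muy = mux ^+ 2 * (muy / mux) by field; exact: lt0r_neq0.
rewrite sqrtrM ?sqr_ge0// sqrtr_sqr gtr0_norm// ler_pM2l// /= le_min.
have q0 : 0 <= muy / mux by rewrite divr_ge0// ltW.
apply/andP; split.
  by rewrite -[leRHS]sqrtr1 ler_sqrt// ler_pdivrMr// mul1r.
have -> : 8 * mux^-1 * muy = 8 * (muy / mux) by ring.
by rewrite ler_sqrt//; lra.
Qed.

End Complexity.

Theorem corollary1 (R : realType) :
  exists c : R, 0 < c /\
  forall (dx dy : nat) (F : 'rV[R]_dx -> 'rV[R]_dy -> R)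
    (r : 'rV[R]_dx -> \bar R) (g : 'rV[R]_dy -> \bar R) (mux muy L : R),
  (0 < dx)%N -> (0 < dy)%N ->
  0 < mux -> 0 < muy -> 0 < L ->
  continuously_differentiable F ->
  (forall y, strongly_convex mux (fun x => F x y)) ->
  (forall x, strongly_convex muy (fun y => - F x y)) ->
  smooth L F ->
  proper_lsc_convex r -> proper_lsc_convex g ->
  muy <= mux ->
  forall (xs : 'rV[R]_dx) (ys : 'rV[R]_dy), minimax_solution F r g xs ys ->
  forall (z0 : 'rV[R]_dx) (y0 : 'rV[R]_dy),
  exists C : R, 2 <= C /\
  forall eps : R, 0 < eps < 1 ->
  exists (K : nat) (s : outer_state R dx dy),
  [/\ (0 < K)%N,
      foam F r g mux muy (tuned_params mux muy L) z0 y0 K = Some s,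
      accurate eps xs ys (foam_output mux s) &
      (out_evals s)%:R <= c * (L / Num.sqrt (mux * muy)) * ln (C / eps)].
Proof.
exists 4000; split; first by rewrite ltr0n.
move=> dx dy F r g mux muy L dx_gt0 _ mux_gt0 muy_gt0 L_gt0.
move=> F_diff F_cvx F_ccv F_smooth r_plc g_plc yx xs ys sol z0 y0.
have [C1 run] := foam_linear_convergence dx_gt0 mux_gt0 muy_gt0 L_gt0
  F_diff F_cvx F_ccv F_smooth r_plc g_plc sol z0 y0.
set Pm := tuned_params mux muy L in run *.
pose c0 := (2 * mux)^-1 + eta_y Pm.
have c0_ge0 : 0 <= c0.
  rewrite addr_ge0 ?invr_ge0 ?mulr_ge0 ?ltW//.
  exact: eta_y_gt0.
(* C >= e makes the logarithm at least 1, so that it absorbs the roundings. *)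
pose C := Num.max (expR 1) (c0 * C1).
have e2 : 2 <= expR 1 :> R by have := expR_ge1Dx (1 : R).
have C_ge : expR 1 <= C by rewrite le_max lexx.
have C_gt0 : 0 < C by lra.
exists C; split; first lra.
move=> eps /andP[eps_gt0 eps_lt1].
set l := ln (C / eps).
have l_ge1 : 1 <= l.
  rewrite -[leLHS](expRK 1) /l ler_ln ?posrE ?expR_gt0 ?divr_gt0//.
  by rewrite ler_pdivlMr//; have := ler_piMr (expR_ge0 1) (ltW eps_lt1); lra.
set al := alpha Pm in run.
have al_gt0 : 0 < al := alpha_gt0 L mux_gt0 muy_gt0.
have al_le1 : al <= 1 := alpha_le1 mux muy L.
have [n n_ge n_le] : exists2 n : nat,
    2 / al * l <= n%:R & n.+1%:R <= 4 * (al^-1 * l).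
  exists (Num.truncn (2 / al * l)).+1; first by rewrite ltW// truncnS_gt.
  have l0 : 0 <= 2 / al * l by rewrite mulr_ge0 ?divr_ge0 ?(ltW al_gt0)//; lra.
  rewrite -addn2 natrD; have : (Num.truncn (2 / al * l))%:R <= 2 / al * l.
    by rewrite truncn_le.
  have : 1 <= al^-1 * l by rewrite mulr_ege1// invf_ge1.
  lra.
have [s [v [sE cv pv ev]]] := run n.
exists n.+1, s; split=> //.
- rewrite /accurate /foam_output /=.
  apply: le_trans (outer_output_le mux_gt0 muy_gt0 L_gt0 F_diff F_cvx F_ccv
    F_smooth r_plc g_plc sol cv) _.
  apply: le_trans (ler_wpM2l c0_ge0 pv) _; rewrite mulrCA mulrC.
  apply: le_trans (exp_decay_le (L := L) mux_gt0 muy_gt0 C_gt0 eps_gt0 (n := n) _).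
    apply: ler_wpM2r; first by apply: exprn_ge0; lra.
    by rewrite le_max lexx orbT.
  exact: n_ge.
- apply: le_trans ev _.
  have Lm0 : 0 <= L / mux by rewrite divr_ge0// ltW.
  have h1 : (mux * al)^-1 <= (Num.sqrt (mux * muy))^-1.
    by rewrite lef_pV2 ?posrE ?sqrtr_gt0 ?mulr_gt0//; exact: alpha_ge.
  have h2 := ler_wpM2r Lm0 n_le.
  have h3 := ler_wpM2l (ltW L_gt0) h1.
  have l_gt0 : 0 <= l by lra.
  have h4 := ler_wpM2r l_gt0 h3.
  rewrite invfM in h4.
  have h5 : 0 <= L * (mux^-1 * al^-1) * l.
    by rewrite !mulr_ge0 ?invr_ge0 ?(ltW L_gt0) ?(ltW mux_gt0) ?(ltW al_gt0).
  lra.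
Qed.
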